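(* Let $m\ge4$ be an integer, let $p$ be a prime, let $f\in\mathbb{F}_p[X]$ with $\deg f=m$, let $R,S$ be integers and let $M$ be an integer with $1\le M<p$. Let $I_f(M;R,S)$ denote the number of integer pairs $(x,y)\in[R+1,R+M]\times[S+1,S+M]$ with $y^2\equiv f(x)\pmod p$. Then, uniformly over all such $p,f,R,S$, $$I_f(M;R,S)\le M\left(\frac{M^3}{p}\right)^{1/(2\kappa(m))+o(1)}+M^{1-(m-3)/(2\kappa(m))+o(1)}$$ as $M\to\infty$.
   Context: Elements of $\mathbb{F}_p$ are identified with $\{0,1,\dots,p-1\}$. For positive integers $k,m,H$, let $J_{k,m}(H)$ be the number of integer solutions $(x_1,\dots,x_{2k})$ with $1\le x_1,\dots,x_{2k}\le H$ of the system $x_1^j+\dots+x_k^j=x_{k+1}^j+\dots+x_{2k}^j$ for $j=1,2,\dots,m$. Let $\kappa(m)$ be the smallest integer $\kappa$ such that for every integer $k\ge\kappa$ there exists a constant $C(k,m)$ depending only on $k,m$ with $J_{k,m}(H)\le C(k,m)H^{2k-m(m+1)/2+o(1)}$ as $H\to\infty$. The notation $M^{o(1)}$ (and the $o(1)$ in exponents) denotes a quantity tending to $0$ as $M\to\infty$, uniformly in $p,f,R,S$ (possibly depending on $m$). *)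

(* Defs.v *)
From HB Require Import structures.
From mathcomp Require Import all_boot all_order all_algebra.
From mathcomp Require Import all_classical all_reals all_analysis.

Set Implicit Arguments.
Unset Strict Implicit.
Unset Printing Implicit Defensive.

Import Order.TTheory GRing.Theory Num.Theory.
Import numFieldNormedType.Exports.

Local Open Scope ring_scope.
Local Open Scope classical_set_scope.

(* The integers in [1, H] are encoded as [i.+1] with [i : 'I_H]; the first
   (resp. second) component of [x] is (x_1, ..., x_k)
   (resp. (x_{k+1}, ..., x_{2k})), and the exponents 1, ..., m are [j.+1]
   with [j : 'I_m]. *)
Definition vinogradov_J (k m H : nat) : nat :=
  #|[set x : {ffun 'I_k -> 'I_H} * {ffun 'I_k -> 'I_H} |
      [forall j : 'I_m,
         (\sum_(i < k) (x.1 i).+1 ^ j.+1)%N ==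
         (\sum_(i < k) (x.2 i).+1 ^ j.+1)%N]]%SET|.

(* J_{k,m}(H) <= C(k,m) H^{2k - m(m+1)/2 + o(1)} as H -> oo, the o(1) being a
   function of H that may depend on k and m. *)
Definition vinogradov_bound (K : realType) (m k : nat) : Prop :=
  exists (C : K) (o : nat -> K),
    o n @[n --> \oo] --> (0 : K) /\
    \forall H \near \oo,
      (vinogradov_J k m H)%:R <=
        C * H%:R `^ ((2 * k)%:R - (m * m.+1)%:R / 2 + o H).

Definition kappa_admissible (K : realType) (m kappa : nat) : Prop :=
  (0 < kappa)%N /\
  forall k : nat, (kappa <= k)%N -> vinogradov_bound K m k.

(* [is_kappa K m kappa] means kappa = kappa(m).  It is a relation because the
   existence of an admissible kappa is a deep theorem. *)
Definition is_kappa (K : realType) (m kappa : nat) : Prop :=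
  kappa_admissible K m kappa /\
  forall kappa' : nat, kappa_admissible K m kappa' -> (kappa <= kappa')%N.

(* The pair (i, j) stands for (x, y) = (R + 1 + i, S + 1 + j), so that x and y
   run over the integers of [R + 1, R + M] and [S + 1, S + M].  The congruence
   modulo p is equality of the images in 'F_p (p is always prime below). *)
Definition curve_points (p : nat) (f : {poly 'F_p}) (M : nat) (R S : int)
    : nat :=
  #|[set ij : 'I_M * 'I_M |
      ((S + 1 + (ij.2 : nat)%:Z)%:~R : 'F_p) ^+ 2 ==
      f.[(R + 1 + (ij.1 : nat)%:Z)%:~R]]%SET|.

Definition admissible (m M p : nat) (f : {poly 'F_p}) : Prop :=
  [/\ prime p, size f = m.+1 & (1 <= M < p)%N].

(* [theta] may depend on all the data, but tends to 0 as M -> oo uniformly in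
   p, f, R, S; the rate may depend on m. *)
Definition uniform_o1 (K : realType) (m : nat)
    (theta : forall M p : nat, {poly 'F_p} -> int -> int -> K) : Prop :=
  forall eps : K, 0 < eps ->
    \forall M \near \oo,
      forall (p : nat) (f : {poly 'F_p}) (R S : int),
        admissible m M f -> `|theta M p f R S| < eps.

(* Main.v *)
(* Translate so that the points are (s + y)^2 = f(x) in F_p with
   0 <= x, y < M, and let X be the set of abscissae; each carries at most two
   points.

   The k-tuples of elements of X are classified by the power sums z_1, ..., z_m
   of the x_i.  Summing the k congruences determines z_m modulo p from the other
   z_j and from the first two power sums of the y_i, so there are
   O(M^(m(m-1)/2 + 3) (M^m / p + 1)) classes, and Cauchy-Schwarz against
   J_{k,m}(M) gives
   |X|^(2k) <= M^(2k + o(1)) (M^3 / p + M^(3 - m)).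
   The factor M^o(1) can be absorbed in the exponents as soon as
   M^3 / p <= M^(-eta) for some fixed eta > 0.

   When M^3 / p lies between M^(-eta) and a constant this absorption fails, and
   a power saving |X| <= M^(1 - delta) is needed instead.  Suppose that X has
   density 1 / Q in [0, M), with Q a small power of M.  Two ingredients are used.
   (1) An inverse Weyl theorem: if a polynomial g of degree d over F_p takes
   values of size at most B on a subset of [0, N) of density 1 / Q, then its
   leading coefficient is A / D with D <= Q^O(1) and |A| <= Q^O(1) B / N^d.
   (2) Take windows of length O(Q) containing n = 4m + 1 elements of X.  A
   Lagrange functional annihilating polynomials of degree m takes values a and b
   on y and y^2 with b = -2sa mod p, |a| <= Q^O(1) M and |b| <= Q^O(1) M^2.
   Either two such pairs differ by some (a, b) with a <> 0 much smaller, and then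
   a (f - s^2) takes the small values a y^2 - b y on X, contradicting (1) as
   M^3 is about p and m > 3; or there are few pairs and two windows share all
   their values of a.  Then the difference of their y is a polynomial q of degree
   at most m, so 4 q^2 f is a square, so f = g^2 with deg g > 1.  This contradicts
   (1) for the polynomials g - s and - g - s, whose values on X are the y < M. *)

Require Import Defs.
From HB Require Import structures.
From mathcomp Require Import all_boot all_order all_algebra.
From mathcomp Require Import all_classical all_reals all_analysis.
From mathcomp Require Import zify ring lra.

Import Order.TTheory GRing.Theory Num.Theory.
Import numFieldNormedType.Exports.

Local Open Scope ring_scope.

(** * Dense sets of integers *)

Definition cnt (N : nat) (P : nat -> Prop) : nat :=
  #|[set i : 'I_N | `[< P i >]]|.

Section Counting.
Local Open Scope nat_scope.

Lemma cnt_sum N P : cnt N P = \sum_(i < N) `[< P i >].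
Proof.
rewrite /cnt -sum1_card big_mkcond /=; apply: eq_bigr => i _.
by rewrite finset.in_set; case: `[< _ >].
Qed.

Lemma cnt_le N (P P' : nat -> Prop) :
  (forall i, i < N -> P i -> P' i) -> cnt N P <= cnt N P'.
Proof.
move=> PP'; apply: subset_leq_card; apply/fintype.subsetP => i.
by rewrite !finset.in_set => /asboolP Pi; apply/asboolP/PP'.
Qed.

Lemma cnt_leN N P : cnt N P <= N.
Proof. by rewrite -[leqRHS]card_ord max_card. Qed.

Lemma cnt_ex N P : 0 < cnt N P -> exists2 i, i < N & P i.
Proof.
case/card_gt0P => i; rewrite finset.in_set => /asboolP Pi.
by exists (val i); [exact: ltn_ord | ].
Qed.

(** Without such a pair, two elements of [P] in one block of length [l] and one class modulo [w.+1]
    coincide, so [P] has at most [b.+1 * w.+1 <= N / (2 Q)] elements below [N], contradicting the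
    density. *)
Lemma dense_pair N l Q (P : nat -> Prop) :
  0 < Q -> 8 * Q <= l <= N -> N <= Q * cnt N P ->
  exists s s', [/\ P s, P s', s < s', s' - s < l & l < 8 * Q * (s' - s)].
Proof.
move=> Q0 /andP[Ql lN] hP; apply: contrapT => noP.
have l0 : 0 < l by lia.
pose w := l %/ (8 * Q); pose b := N %/ l.
pose h (s : 'I_N) : 'I_b.+1 * 'I_w.+1 := (inord (s %/ l), inord (s %% w.+1)).
have wl : w * (8 * Q) <= l by apply: leq_trunc_div.
have bl : b * l <= N by apply: leq_trunc_div.
have b1 : 0 < b by rewrite divn_gt0.
have key (s s' : nat) : s < s' -> P s -> P s' -> s %/ l = s' %/ l ->
    s %% w.+1 = s' %% w.+1 -> False.
  move=> ss' Ps Ps' e1 e2; apply: noP; exists s, s'; split => //.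
    have := ltn_pmod s' l0; rewrite {2}(divn_eq s' l) {1}(divn_eq s l) e1 subnDl.
    by move=> ?; apply: leq_ltn_trans (leq_subr _ _) _.
  have : w.+1 %| s' - s by rewrite -eqn_mod_dvd ?(ltnW ss') // e2.
  have d0 : 0 < s' - s by rewrite subn_gt0.
  move=> /(dvdn_leq d0) hw.
  by rewrite [X in _ < X]mulnC -ltn_divLR // muln_gt0.
have hinj : {in [set i : 'I_N | `[< P i >]] &, injective h}.
  move=> s s'; rewrite !finset.in_set => /asboolP Ps /asboolP Ps' [].
  move=> /(congr1 val); rewrite /= !inordK ?ltnS ?leq_div2r ?(ltnW (ltn_ord _)) //.
  move=> e1 /(congr1 val); rewrite /= !inordK ?ltn_mod //; move=> e2.
  apply/val_inj; case: (ltngtP s s') => // ss'.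
    by case: (key _ _ ss').
  by case: (key _ _ ss').
have := @leq_card_in _ _ h _ hinj; rewrite -/(cnt N P) card_prod !card_ord => hc.
have h1 : N <= Q * (b.+1 * w.+1) by rewrite (leq_trans hP) // leq_mul2l hc orbT.
have h2 : b.+1 * (8 * Q * w.+1) <= b.+1 * (2 * l) by rewrite leq_mul2l; apply/orP; right; lia.
have h3 : b.+1 * (2 * l) <= (b + b) * (2 * l) by rewrite leq_mul2r; apply/orP; right; lia.
lia.
Qed.

Lemma pigeonhole_sum N (c : 'I_N.+1 -> nat) (S : nat) :
  S <= \sum_i c i -> exists i, S <= N.+1 * c i.
Proof.
move=> hS; apply: contrapT => hno.
have hlt i : N.+1 * c i < S.
  by rewrite ltnNge; apply/negP => h; apply: hno; exists i.
have : \sum_i N.+1 * c i < \sum_(i < N.+1) S.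
  rewrite !big_ord_recl -addSn leq_add //.
  by apply: leq_sum => i _; apply: ltnW.
rewrite -big_distrr sum_nat_const card_ord /= => h.
have := leq_trans h (leq_mul (leqnn N.+1) hS).
by rewrite ltnn.
Qed.

(** By symmetry at least half of the pairs satisfy [x <= y], and these are grouped by [t = y - x].
    Points [x + t] beyond [N] only enlarge the right-hand side. *)
Lemma cnt_pairs N (P : nat -> Prop) :
  (cnt N P) ^ 2 <= 2 * \sum_(t < N) cnt N (fun x => P x /\ P (x + t)).
Proof.
pose F (i : nat) : nat := `[< P i >].
have hF (i j : nat) : `[< P i /\ P j >] = F i * F j :> nat.
  by rewrite /F asbool_and; case: `[< P i >]; case: `[< P j >].
have -> : \sum_(t < N) cnt N (fun x => P x /\ P (x + t))
    = \sum_(x < N) \sum_(t < N) F x * F (x + t).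
  by rewrite exchange_big; apply: eq_bigr => t _; rewrite cnt_sum;
     apply: eq_bigr => x _; rewrite hF.
have hhalf : \sum_(x < N) \sum_(y < N | x <= y) F x * F y <=
    \sum_(x < N) \sum_(t < N) F x * F (x + t).
  apply: leq_sum => x _.
  rewrite -(big_mkord (fun y => x <= y) (fun y => F x * F y)).
  rewrite -(big_mkord xpredT (fun t => F x * F (x + t))).
  rewrite (big_cat_nat (leq0n x)) /=; last exact: ltnW.
  rewrite big_nat_cond big1 ?add0n; last by move=> i; lia.
  rewrite -{1}[x : nat]add0n big_addn.
  rewrite [leqRHS](big_cat_nat (leq0n (N - x))) /=; last exact: leq_subr.
  apply: leq_trans (leq_addr _ _).
  rewrite big_mkcond; apply: leq_sum => i _.
  by case: ifP => // _; rewrite addnC.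
have -> : cnt N P ^ 2 = \sum_(x < N) \sum_(y < N) F x * F y.
  rewrite -mulnn {1}cnt_sum big_distrl; apply: eq_bigr => x _.
  by rewrite cnt_sum big_distrr.
have h2 : \sum_(x < N) \sum_(y < N) F x * F y <=
   \sum_(x < N) \sum_(y < N | x <= y) F x * F y +
   \sum_(x < N) \sum_(y < N | y <= x) F x * F y.
  rewrite -big_split /=; apply: leq_sum => x _.
  rewrite [X in X + _]big_mkcond [X in _ + X]big_mkcond -big_split /=.
  by apply: leq_sum => y _; case: (leqP x y); case: (leqP y x) => /=; lia.
have h3 : \sum_(x < N) \sum_(y < N | y <= x) F x * F y =
   \sum_(x < N) \sum_(y < N | x <= y) F x * F y.
  under eq_bigr => x _ do rewrite big_mkcond.
  under [RHS]eq_bigr => x _ do rewrite big_mkcond.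
  rewrite exchange_big; apply: eq_bigr => x _; apply: eq_bigr => y _.
  by rewrite mulnC.
rewrite h3 in h2; lia.
Qed.

(** Popular differences: shifts with fewer than [N / (4 Q^2)] pairs account for at most half of the
    guaranteed total, so the others, contributing at most [N] each, are numerous. *)
Lemma cnt_pairs_dense N Q (P : nat -> Prop) : N <= Q * cnt N P ->
  N <= 4 * Q ^ 2 *
    cnt N (fun t => N <= 4 * Q ^ 2 * cnt N (fun x => P x /\ P (x + t))).
Proof.
move=> hP; have hpairs := cnt_pairs N P.
set c := fun t : nat => cnt N (fun x => P x /\ P (x + t)).
have hs : 4 * Q ^ 2 * \sum_(t < N) c t <=
   4 * Q ^ 2 * (N * cnt N (fun t => N <= 4 * Q ^ 2 * c t)) + N * N.
  have -> : N * N = \sum_(t < N) N by rewrite sum_nat_const card_ord.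
  rewrite cnt_sum !big_distrr -big_split /=; apply: leq_sum => t _.
  have := cnt_leN N (fun x => P x /\ P (x + t)); rewrite -/(c t) => hc.
  case: asboolP; first by move=> _; rewrite muln1 (leq_trans _ (leq_addr _ _)) // leq_mul2l hc orbT.
  by move=> /negP; rewrite -ltnNge => /ltnW h; rewrite !muln0.
have h1 : N * N <= Q ^ 2 * cnt N P ^ 2 by rewrite -expnMn -mulnn leq_mul.
case: (posnP N) => [-> //|N0].
rewrite -(leq_pmul2l N0).
set S := \sum_(t < N) _ in hpairs hs.
set G := cnt N (fun t => N <= _) in hs *.
have h4 : 2 * (Q ^ 2 * cnt N P ^ 2) <= 4 * Q ^ 2 * S.
  have -> : 4 * Q ^ 2 * S = 2 * (Q ^ 2 * (2 * S)) by lia.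
  by rewrite leq_mul2l /= leq_mul2l hpairs orbT.
lia.
Qed.

End Counting.

(** * An inverse Weyl theorem *)

Definition small (p B : nat) (a : 'F_p) : Prop :=
  exists2 v : int, (`|v| <= B)%N & v%:~R = a.

Lemma intr_Fp_eq0 p (v : int) : prime p -> (v%:~R == 0 :> 'F_p) = (p %| `|v|)%N.
Proof.
by move=> pp; rewrite -(dvdz_pcharf (pchar_Fp pp)).
Qed.

Lemma intr_Fp_inj0 p (v : int) : prime p -> (`|v| < p)%N ->
  v%:~R = 0 :> 'F_p -> v = 0.
Proof.
move=> pp vp /eqP; rewrite intr_Fp_eq0 // => /dvdn_leq h.
by apply/eqP; rewrite -absz_eq0 -leqn0 leqNgt; apply/negP => /h; lia.
Qed.

Lemma smallB p B1 B2 (a b : 'F_p) :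
  small p B1 a -> small p B2 b -> small p (B1 + B2) (a - b).
Proof.
by move=> [v hv <-] [w hw <-]; exists (v - w); [lia | rewrite rmorphB].
Qed.

(* If alpha t is small for a positive proportion of the t < N, then two close
   such t show that alpha is near a rational with small denominator D; pairs at
   distance about min N (p / 2 |A|) then improve the bound on A = D alpha. *)
Lemma linear_inverse p (alpha : 'F_p) N Q B :
  prime p -> (0 < Q)%N -> (8 * Q <= N)%N -> (512 * Q ^ 2 * B <= p)%N ->
  (N <= Q * cnt N (fun t => small p B (alpha * t%:R)%R))%N ->
  exists D : nat, exists A : int,
    [/\ (0 < D < 8 * Q)%N, (`|A| * N <= 128 * Q ^ 2 * B)%N &
        A%:~R = D%:R * alpha].
Proof.
move=> pp Q0 QN Bp hP.
have diff s s' : (s < s')%N -> small p B (alpha * s%:R) ->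
    small p B (alpha * s'%:R) ->
    small p (B + B) (alpha * (s' - s)%:R).
  move=> ss' h h'; rewrite natrB ?(ltnW ss') // mulrBr.
  exact: smallB.
have [| s [s' [Ps Ps' ss' s1 _]]] := @dense_pair N (8 * Q) Q _ Q0 _ hP.
  by rewrite leqnn QN.
have [A hA eA] := diff _ _ ss' Ps Ps'.
exists (s' - s)%N, A; split; [lia | | by rewrite eA mulrC].
case: (posnP `|A|) => [-> //|A0].
(* This length keeps [2 |A| w] below [p] for all [w < l]; with the bound on [D |u|], the congruence
   [A w = D u] modulo [p] becomes an equality of integers. *)
pose l := minn N (p %/ (2 * `|A|)).
have lp : (l * (2 * `|A|) <= p)%N.
  by rewrite (leq_trans _ (leq_trunc_div p (2 * `|A|))) // leq_mul2r geq_minr orbT.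
have hl : (8 * Q <= l <= N)%N.
  rewrite geq_minl andbT leq_min QN leq_divRL; last by lia.
  rewrite (leq_trans _ Bp) // (_ : 512 * Q ^ 2 * B = 8 * Q * (64 * Q * B))%N; last by lia.
  rewrite leq_mul2l; apply/orP; right; nia.
have [t [t' [Pt Pt' tt' t1 t2]]] := @dense_pair N l Q _ Q0 hl hP.
have [u hu eu] := diff _ _ tt' Pt Pt'.
set D := (s' - s)%N in s1 eA *.
set w := (t' - t)%N in t1 t2 eu *.
have hDu : (D * `|u| <= 16 * Q * B)%N.
  rewrite (_ : 16 * Q * B = 8 * Q * (B + B))%N; last by lia.
  by apply: leq_mul => //; exact: ltnW.
have hAw : (`|A| * w * 2 < p)%N.
  apply: leq_trans lp; rewrite (_ : `|A| * w * 2 = w * (2 * `|A|))%N; last by lia.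
  by rewrite ltn_pmul2r //; lia.
have eAw : A * w%:Z = D%:Z * u.
  apply/eqP; rewrite -subr_eq0; apply/eqP; apply: (@intr_Fp_inj0 p) => //.
    have : (16 * Q * B * 2 <= p)%N.
      apply: leq_trans Bp; rewrite (_ : 512 * Q ^ 2 * B = 16 * Q * B * (32 * Q))%N; last by lia.
      by rewrite leq_mul2l; apply/orP; right; lia.
    have h1 : absz (A * w%:Z) = (`|A| * w)%N by rewrite abszM.
    have h2 : absz (D%:Z * u) = (D * `|u|)%N by rewrite abszM.
    lia.
  by rewrite rmorphB !rmorphM /= eA eu -!pmulrn; ring.
have hAw2 : (`|A| * w <= 16 * Q * B)%N.
  by have := congr1 absz eAw; rewrite !abszM => ->.
have hAl : (`|A| * l < 128 * Q ^ 2 * B)%N.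
  have h : (`|A| * l < `|A| * (8 * Q * w))%N by rewrite ltn_pmul2l.
  apply: leq_trans h _.
  rewrite (_ : `|A| * (8 * Q * w) = 8 * Q * (`|A| * w))%N; last by lia.
  rewrite (_ : 128 * Q ^ 2 * B = 8 * Q * (16 * Q * B))%N; last by lia.
  by rewrite leq_mul2l hAw2 orbT.
(* If [p / (2 |A|) < N], then [4 |A| l] exceeds [p], against the assumption on [B]. *)
have [lN|lN] := leqP N (p %/ (2 * `|A|)).
  by move: hAl; rewrite /l (minn_idPl lN) => /ltnW.
have el : l = (p %/ (2 * `|A|))%N by rewrite /l (minn_idPr (ltnW lN)).
have hpl : (p < l.+1 * (2 * `|A|))%N by rewrite el ltn_ceil //; lia.
have : (l.+1 * (2 * `|A|) <= 4 * (`|A| * l))%N.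
  rewrite (_ : 4 * (`|A| * l) = (l + l) * (2 * `|A|))%N; last by lia.
  rewrite leq_mul2r; apply/orP; right; lia.
lia.
Qed.

(** * Coefficients of translated polynomials *)

Lemma coef_XaddC_exp (R : comNzRingType) (a : R) n j :
  (('X + a%:P) ^+ n)`_j = a ^+ (n - j) *+ 'C(n, j).
Proof.
rewrite addrC exprDn coef_sum.
under eq_bigr => i _ do rewrite -polyC_exp coefMn coefCM coefXn.
have [jn|jn] := ltnP j n.+1.
  rewrite (bigD1 (Ordinal jn)) //= eqxx mulr1 big1 ?addr0 // => i /negPf ij.
  have -> : (j == i :> nat) = false.
    by apply/negbTE; apply: contraFN ij => /eqP ij; apply/eqP/val_inj; rewrite /= ij.
  by rewrite mulr0 mul0rn.
rewrite bin_small // mulr0n big1 // => i _.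
have -> : (j == i :> nat) = false by have := ltn_ord i; lia.
by rewrite mulr0 mul0rn.
Qed.

Lemma coef_comp_XaddC (R : comNzRingType) (a : R) (g : {poly R}) d j :
  (size g <= d)%N ->
  (g \Po ('X + a%:P))`_j = \sum_(i < d) g`_i * (a ^+ (i - j) *+ 'C(i, j)).
Proof.
move=> sg; rewrite coef_comp_poly.
rewrite (big_ord_widen _ (fun i => g`_i * (('X + a%:P) ^+ i)`_j) sg) big_mkcond.
apply: eq_bigr => i _; rewrite coef_XaddC_exp; case: ltnP => // h.
by rewrite nth_default // mul0r.
Qed.

Lemma coef_comp_XaddC_subtop (R : comNzRingType) (a : R) (g : {poly R}) d :
  (size g <= d.+2)%N ->
  (g \Po ('X + a%:P))`_d = g`_d + a * g`_d.+1 *+ d.+1.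
Proof.
move=> sg; rewrite (coef_comp_XaddC _ _ _ _ _ sg) !big_ord_recr /= big1 ?add0r.
  by rewrite subnn binn mulr1n mulr1 subSnn binSn expr1 mulrnAr [a * _]mulrC.
by move=> i _; rewrite bin_small // mulr0.
Qed.

Lemma coef_comp_XaddC_top (R : comNzRingType) (a : R) (g : {poly R}) d :
  (size g <= d.+1)%N -> (g \Po ('X + a%:P))`_d = g`_d.
Proof.
move=> sg; rewrite (coef_comp_XaddC _ _ _ _ _ sg) !big_ord_recr /= big1 ?add0r.
  by rewrite subnn binn mulr1n mulr1.
by move=> i _; rewrite bin_small // mulr0.
Qed.

Lemma size_comp_XaddC (R : idomainType) (a : R) (g : {poly R}) :
  size (g \Po ('X + a%:P)) = size g.
Proof. by rewrite size_comp_poly2 // size_XaddC. Qed.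

Lemma leq_mul_exp Q x y a b :
  (x <= Q ^ a)%N -> (y <= Q ^ b)%N -> (x * y <= Q ^ (a + b))%N.
Proof. by move=> xa yb; rewrite expnD leq_mul. Qed.

Lemma leq_const_exp Q c a : (1 < Q)%N -> (c <= 2 ^ a)%N -> (c <= Q ^ a)%N.
Proof.
move=> Q1 /leq_trans -> //; case: a => [//|a]; by rewrite leq_exp2r.
Qed.

Lemma cnt_cover N K (P : nat -> Prop) (R : 'I_K -> nat -> Prop) :
  (forall t, (t < N)%N -> P t -> exists i, R i t) ->
  (cnt N P <= \sum_i cnt N (R i))%N.
Proof.
move=> PR; under eq_bigr => i _ do rewrite cnt_sum.
rewrite cnt_sum exchange_big; apply: leq_sum => t _.
case: asboolP => // /(PR _ (ltn_ord t)) [i Ri].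
by rewrite (bigD1 i) //=; case: asboolP.
Qed.

(** Exponent of [Q] lost by the inverse theorem in degree [d]. A differencing step replaces [Q] by
    [4 Q^2 <= Q^4]; the summands [20] and [d'] absorb numerical constants and the factor [d'.+1] of
    the differenced leading coefficient. *)
Fixpoint cW (d : nat) : nat :=
  if d is d'.+1 then (20 + 12 * cW d' + d')%N else 1%N.

(** Weyl differencing, by induction on [d]. For a popular shift [t], the polynomial [g(X + t) - g]
    is small on a dense set and has leading coefficient [t * gam], so by induction some
    [i * gam * t] with [0 < i <= E] is small. A common [i] for many [t], found by pigeonhole,
    reduces to the linear case. *)
Lemma weyl_inverse d p N Q B (g : {poly 'F_p}) :
  prime p -> (1 < Q)%N -> (size g <= d.+1)%N ->
  (Q ^ cW d <= N)%N -> (B * Q ^ cW d <= p)%N ->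
  (N <= Q * cnt N (fun x => small p B g.[x%:R]%R))%N ->
  exists D : nat, exists A : int,
    [/\ (0 < D <= Q ^ cW d)%N, (`|A| * N ^ d <= Q ^ cW d * B)%N &
        A%:~R = D%:R * g`_d].
Proof.
move=> pp; elim: d N Q B g => [|d IH] N Q B g Q1 sg QN QB hP.
  have N0 : (0 < N)%N by apply: leq_trans QN; rewrite expn_gt0; lia.
  have [x _ [v hv ev]] : exists2 x, (x < N)%N & small p B g.[x%:R].
    by apply: cnt_ex; move: hP; case: cnt => //; lia.
  exists 1%N, v; split; [by rewrite /= expn_gt0; lia| |].
    by rewrite expn0 muln1 (leq_trans hv) // leq_pmull // expn_gt0; lia.
  by rewrite ev mul1r (size1_polyC sg) hornerC coefC.
pose Q' := (4 * Q ^ 2)%N; pose E := (Q' ^ cW d)%N; pose C := cW d.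
have hQ' : (Q' <= Q ^ 4)%N.
  by rewrite /Q' (_ : 4 = 2 + 2)%N // leq_mul_exp // leq_const_exp.
have hE : (E <= Q ^ (4 * C))%N.
  by rewrite expnM /E -/C; case: (C) => // n; rewrite leq_exp2r.
have Q'0 : (0 < Q')%N by rewrite /Q'; lia.
have E0 : (0 < E)%N by rewrite expn_gt0 Q'0.
have hE1 : (E.+1 <= Q ^ (1 + 4 * C))%N.
  apply: (@leq_trans (2 * E)); first by lia.
  by apply: leq_mul_exp; rewrite ?expn1.
have pwN a : (a <= cW d.+1)%N -> (Q ^ a <= N)%N.
  by move=> ha; apply: leq_trans QN; rewrite leq_exp2l.
have pwp a x : (x <= Q ^ a)%N -> (a <= cW d.+1)%N -> (x * B <= p)%N.
  move=> hx ha; apply: leq_trans QB; rewrite mulnC leq_mul2l.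
  by rewrite (leq_trans hx) ?leq_exp2l ?orbT.
have hgood := cnt_pairs_dense _ _ _ hP; rewrite -/Q' in hgood.
pose B' := (E * (B + B) %/ N ^ d)%N.
have N0 : (0 < N)%N by apply: leq_trans QN; rewrite expn_gt0; lia.
pose gam := g`_d.+1 *+ d.+1.
(* The index [i] is the denominator given by induction; [i = 0] would make smallness vacuous. *)
pose R (i : 'I_E.+1) (t : nat) := (0 < i)%N /\ small p B' (i%:R * gam * t%:R).
have cover t : (t < N)%N ->
    (N <= Q' * cnt N (fun x => small p B g.[x%:R]%R /\ small p B g.[(x + t)%:R]%R))%N ->
    exists i, R i t.
  move=> _ ht; pose h := g \Po ('X + (t%:R)%:P) - g.
  have sh : (size h <= d.+1)%N.
    apply/leq_sizeP => j; rewrite leq_eqVlt coefB => /orP[/eqP <-|jd].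
      by rewrite coef_comp_XaddC_top // subrr.
    by rewrite !nth_default ?subrr // ?size_comp_XaddC (leq_trans sg).
  have hd : h`_d = t%:R * gam.
    by rewrite coefB coef_comp_XaddC_subtop // addrC addKr mulrnAr.
  have [| | | |D [A [/andP[D0 DE] hA eA]]] := IH N Q' (B + B)%N h _ sh.
  - by rewrite /Q'; lia.
  - by apply: leq_trans hE _; apply: pwN; rewrite /= -/C; lia.
  - rewrite -/E mulnC (_ : E * (B + B) = 2 * E * B)%N; last by lia.
    apply: (pwp (1 + 4 * C)%N); last by rewrite /= -/C; lia.
    by apply: leq_mul_exp; rewrite ?expn1.
  - apply: leq_trans ht _; rewrite leq_mul2l; apply/orP; right.
    apply: cnt_le => x _ [h1 h2].
    rewrite /h hornerD hornerN horner_comp hornerD hornerX hornerC -natrD.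
    exact: smallB.
  have DE' : (D < E.+1)%N by [].
  exists (Ordinal DE'); split => //=; exists A.
    by rewrite leq_divRL ?expn_gt0 ?N0.
  by rewrite eA hd; ring.
have [i hi] := pigeonhole_sum _ _ _ (cnt_cover _ _ _ _ cover).
have i0 : (0 < i)%N.
  have : (0 < cnt N (R i))%N by case: (cnt N (R i)) hi => //; lia.
  by case/cnt_ex => ? _ [].
pose Q2 := (Q' * E.+1)%N.
have hQ2 : (Q2 <= Q ^ (5 + 4 * C))%N.
  by rewrite (_ : 5 + 4 * C = 4 + (1 + 4 * C))%N; [exact: leq_mul_exp | lia].
have Q20 : (0 < Q2)%N by rewrite muln_gt0 Q'0.
have h2E : (2 * E <= Q ^ (1 + 4 * C))%N by apply: leq_mul_exp; rewrite ?expn1.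
have hQ22 : (Q2 ^ 2 <= Q ^ (5 + 4 * C + (5 + 4 * C)))%N.
  by rewrite -mulnn leq_mul_exp.
have hB' : (B' <= 2 * E * B)%N.
  by rewrite (leq_trans (leq_div _ _)) // (_ : 2 * E * B = E * (B + B))%N //; lia.
have [| | |D [A [/andP[D0 DQ] hA eA]]] :=
  linear_inverse p (i%:R * gam) N Q2 B' pp Q20.
- apply: (@leq_trans (Q ^ (3 + (5 + 4 * C)))%N); last by apply: pwN; rewrite /= -/C; lia.
  by apply: leq_mul_exp => //; apply: leq_const_exp.
- apply: (@leq_trans (512 * Q2 ^ 2 * (2 * E * B))%N); first by rewrite leq_mul2l hB' orbT.
  rewrite mulnA; apply: (pwp (9 + (5 + 4 * C + (5 + 4 * C)) + (1 + 4 * C))%N);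
    last by rewrite /= -/C; lia.
  by do 2! apply: leq_mul_exp => //; apply: leq_const_exp.
- apply: leq_trans hgood _; rewrite /Q2 -mulnA leq_mul2l; apply/orP; right.
  apply: leq_trans hi _; rewrite leq_mul2l; apply/orP; right.
  by apply: cnt_le => t _ [].
have iE : (i <= E)%N by rewrite -ltnS.
exists (D * (i * d.+1))%N, A; split.
- rewrite !muln_gt0 D0 i0 /=.
  apply: (@leq_trans (Q ^ (3 + (5 + 4 * C) + (4 * C + d.+1)))%N);
    last by rewrite leq_exp2l //= -/C; lia.
  apply: leq_mul_exp; first by apply: ltnW; apply: leq_trans DQ _;
    apply: leq_mul_exp => //; apply: leq_const_exp.
  apply: leq_mul_exp; first exact: leq_trans hE.
  by apply: leq_const_exp => //; apply: ltnW (ltn_expl _ _).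
- rewrite expnS mulnA.
  apply: (@leq_trans (128 * Q2 ^ 2 * B' * N ^ d)%N); first by rewrite leq_mul2r hA orbT.
  rewrite -mulnA; apply: (@leq_trans (128 * Q2 ^ 2 * (2 * E * B))%N).
    rewrite leq_mul2l (leq_trans (leq_trunc_div _ _)) ?orbT //.
    by rewrite (_ : 2 * E * B = E * (B + B))%N //; lia.
  rewrite mulnA leq_mul2r; apply/orP; right.
  apply: (@leq_trans (Q ^ (7 + (5 + 4 * C + (5 + 4 * C)) + (1 + 4 * C)))%N);
    last by rewrite leq_exp2l //= -/C; lia.
  by do 2! apply: leq_mul_exp => //; apply: leq_const_exp.
- by rewrite eA /gam !natrM; ring.
Qed.

(** * Lagrange functionals and coincident windows *)

Lemma size_mul_exp (F : idomainType) (f g : {poly F}) a b :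
  (size f <= a.+1)%N -> (size g <= b.+1)%N -> (size (f * g)%R <= (a + b).+1)%N.
Proof.
move=> fa gb; apply: leq_trans (size_polyMleq _ _) _; lia.
Qed.

Lemma poly_eq0_inj (F : fieldType) n (t : 'I_n -> F) (g : {poly F}) :
  injective t -> (forall i, g.[t i] = 0) -> (size g <= n)%N -> g = 0.
Proof.
move=> tinj gt sg; apply: (@roots_geq_poly_eq0 _ g [seq t i | i : 'I_n]).
- by apply/allP => x /mapP[i _ ->]; apply/rootP.
- by rewrite map_inj_uniq ?enum_uniq.
- by rewrite size_map size_enum_ord.
Qed.

(* With A and A' the two shifts of f, w - w' = q and w^2 - w'^2 = A - A' give
   2 q w = q^2 + A - A' at more points than the degrees allow. *)
Lemma square_of_collision (F : fieldType) m n (f q : {poly F}) (a a' : F)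
    (t w w' : 'I_n -> F) :
  (0 < m)%N -> m%:R != 0 :> F -> 2 != 0 :> F -> size f = m.+1 ->
  (4 * m < n)%N -> injective t -> a != a' -> (size q <= m.+1)%N ->
  (forall i, w i ^+ 2 = f.[t i + a]) -> (forall i, w' i ^+ 2 = f.[t i + a']) ->
  (forall i, w i - w' i = q.[t i]) ->
  exists g : {poly F}, f = g ^+ 2.
Proof.
move=> m0 mF F2 sf mn tinj aa' sq hw hw' hq.
pose A := f \Po ('X + a%:P); pose A' := f \Po ('X + a'%:P).
have sA : (size A <= m.+1)%N by rewrite size_comp_XaddC sf.
have sA' : (size A' <= m.+1)%N by rewrite size_comp_XaddC sf.
have eA i : A.[t i] = w i ^+ 2.
  by rewrite hw horner_comp hornerD hornerX hornerC.
have eA' i : A'.[t i] = w' i ^+ 2.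
  by rewrite hw' horner_comp hornerD hornerX hornerC.
pose r := q ^+ 2 + A - A'.
have sr : (size r <= (m + m).+1)%N.
  rewrite /r -addrA (leq_trans (size_polyD _ _)) // geq_max; apply/andP; split.
    by rewrite expr2 size_mul_exp.
  rewrite (leq_trans (size_polyD _ _)) // size_polyN geq_max.
  by rewrite (leq_trans sA) ?(leq_trans sA') // ltnS leq_addr.
have sq2 : (size (q *+ 2)%R <= m.+1)%N.
  by rewrite mulr2n (leq_trans (size_polyD _ _)) // maxnn.
(* Both sides have degree at most [4 m] and agree at the [n > 4 m] points [t i], where
   [r = 2 q w]. *)
have er : (q *+ 2) ^+ 2 * A = r ^+ 2.
  apply/eqP; rewrite -subr_eq0; apply/eqP; apply: poly_eq0_inj tinj _ _.
    move=> i; rewrite hornerD hornerN /r !(hornerM, expr2, hornerD, hornerN) /=.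
    by rewrite ?hornerMn eA eA' -hq; ring.
  rewrite (leq_trans (size_polyD _ _)) // size_polyN geq_max; apply/andP; split.
    apply: (@leq_trans (m + m + m).+1); last by lia.
    by apply: size_mul_exp sA; rewrite expr2 size_mul_exp.
  apply: (@leq_trans (m + m + (m + m)).+1); last by lia.
  by rewrite expr2 size_mul_exp.
(* If [q = 0], the two translates of [f] coincide, and their coefficients just below the top force
   [a = a'], as [m] is nonzero in [F]. *)
have [q0|q0] := eqVneq q 0.
  have eAA : A = A'.
    move: er; rewrite q0 mul0rn expr0n mul0r => /esym/eqP.
    rewrite expf_eq0 /= /r q0 expr0n add0r subr_eq0 => /eqP //.
  case: m m0 mF sf {sq mn sA sA' sr sq2} => // d _ mF sf.
  have := congr1 (fun h : {poly F} => h`_d) eAA.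
  rewrite !coef_comp_XaddC_subtop ?sf // => /addrI /eqP.
  rewrite -subr_eq0 -mulrnBl -mulrBl -mulr_natl !mulf_eq0 (negPf mF) subr_eq0.
  rewrite (negPf aa') /=.
  have -> : f`_d.+1 = lead_coef f by rewrite /lead_coef sf.
  by rewrite lead_coef_eq0 -size_poly_eq0 sf.
have q2 : q *+ 2 != 0 by rewrite -scaler_nat scaler_eq0 negb_or F2.
have : (q *+ 2) ^+ 2 %| r ^+ 2 by rewrite -er dvdp_mulr.
rewrite dvdp_pexp2r // => /dvdpP[g eg].
have eAg : A = g ^+ 2.
  by apply: (mulfI (expf_neq0 2 q2)); rewrite er eg exprMn mulrC.
exists (g \Po ('X - a%:P)).
by rewrite expr2 -comp_polyM -expr2 -eAg /A comp_polyXaddC_K.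
Qed.

Section Lagrange.
Variables (m L : nat) (t : 'I_m.+1 -> nat).
Hypotheses (tinj : injective t) (tL : forall i, (t i < L)%N).

(** Interpolation with denominators cleared: [lagrange_num i u / lagrange_den] is the value at [u]
    of the basis polynomial of node [i]. Staying over the integers allows size bounds by powers of
    [L]. *)
Definition lagrange_scale (i : 'I_m.+1) : int :=
  \prod_(i' | i' != i) \prod_(k | k != i') ((t i')%:Z - (t k)%:Z).
Definition lagrange_den : int :=
  \prod_i \prod_(k | k != i) ((t i)%:Z - (t k)%:Z).
Definition lagrange_num (i : 'I_m.+1) (u : nat) : int :=
  lagrange_scale i * \prod_(k | k != i) (u%:Z - (t k)%:Z).

Lemma absz_prod_le (I : finType) (P : pred I) (F : I -> int) B :
  (forall i, P i -> (absz (F i) <= B)%N) ->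
  (absz (\prod_(i | P i) F i)%R <= B ^ #|P|)%N.
Proof.
move=> FB; rewrite -prod_nat_const.
elim/big_rec2: _ => // i x y Pi h; rewrite abszM.
by apply: leq_mul => //; exact: FB.
Qed.

Lemma card_neq_ord (i : 'I_m.+1) : #|[pred k | k != i]| = m.
Proof. by rewrite cardC1 card_ord. Qed.

Lemma absz_prod_node_le (i : 'I_m.+1) u : (u < L)%N ->
  (absz (\prod_(k | k != i) (u%:Z - (t k)%:Z))%R <= L ^ m)%N.
Proof.
move=> uL; rewrite -[X in (_ <= _ ^ X)%N](card_neq_ord i).
by apply: absz_prod_le => k _; have := tL k; lia.
Qed.

Lemma lagrange_den_le : (`|lagrange_den| <= (L ^ m) ^ m.+1)%N.
Proof.
rewrite -[X in (_ <= _ ^ X)%N](card_ord m.+1).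
apply: absz_prod_le => i _; exact: absz_prod_node_le.
Qed.

Lemma lagrange_num_le i u : (u < L)%N ->
  (absz (lagrange_num i u) <= (L ^ m) ^ m.+1)%N.
Proof.
move=> uL; rewrite abszM expnS mulnC leq_mul ?absz_prod_node_le //.
rewrite -[X in (_ <= _ ^ X)%N](card_neq_ord i).
by apply: absz_prod_le => k _; exact: absz_prod_node_le.
Qed.

Variable p : nat.
Hypotheses (pp : prime p) (Lp : (L <= p)%N).

Lemma node_neq (i k : 'I_m.+1) : k != i -> (t i)%:R - (t k)%:R != 0 :> 'F_p.
Proof.
move=> ki; apply/negP => /eqP h.
have : ((t i)%:Z - (t k)%:Z)%:~R = 0 :> 'F_p by rewrite rmorphB.
move/(@intr_Fp_inj0 p _ pp); have := tL i; have := tL k => h1 h2 h3.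
have e : t k = t i by lia.
by move/tinj: e => e; rewrite e eqxx in ki.
Qed.

Lemma lagrange_den_neq0 : lagrange_den%:~R != 0 :> 'F_p.
Proof.
rewrite rmorph_prod; apply/prodf_neq0 => i _.
rewrite rmorph_prod; apply/prodf_neq0 => k ki.
by rewrite rmorphB; apply: node_neq.
Qed.

Definition lagrange_poly (i : 'I_m.+1) : {poly 'F_p} :=
  (lagrange_scale i)%:~R *: \prod_(k | k != i) ('X - ((t k)%:R)%:P).

Lemma lagrange_polyE i u : (lagrange_poly i).[u%:R] = (lagrange_num i u)%:~R.
Proof.
rewrite hornerZ rmorphM horner_prod rmorph_prod; congr (_ * _).
by apply: eq_bigr => k _; rewrite !hornerE rmorphB.
Qed.

Lemma size_lagrange_poly i : (size (lagrange_poly i) <= m.+1)%N.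
Proof.
rewrite (leq_trans (size_scale_leq _ _)) // -big_filter size_prod_XsubC.
by rewrite size_filter -sum1_count sum1_card card_neq_ord.
Qed.

Lemma lagrange_num_node (i k : 'I_m.+1) :
  lagrange_num i (t k) = if k == i then lagrange_den else 0.
Proof.
rewrite /lagrange_num; have [->|ki] := eqVneq k i.
  by rewrite /lagrange_den [RHS](bigD1 i) //= mulrC.
by rewrite (bigD1 k) //= subrr mul0r mulr0.
Qed.

Lemma lagrange_interpolation (q : {poly 'F_p}) u : (size q <= m.+1)%N ->
  lagrange_den%:~R * q.[u%:R] =
    \sum_i (lagrange_num i u)%:~R * q.[(t i)%:R].
Proof.
move=> sq; pose r := lagrange_den%:~R *: q -
  \sum_i q.[(t i)%:R] *: lagrange_poly i.
have hr x : r.[x%:R] = lagrange_den%:~R * q.[x%:R] -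
    \sum_i (lagrange_num i x)%:~R * q.[(t i)%:R].
  rewrite hornerD hornerN hornerZ horner_sum; congr (_ - _).
  by apply: eq_bigr => i _; rewrite hornerZ lagrange_polyE mulrC.
suff r0 : r = 0 by apply/eqP; rewrite -subr_eq0 -hr r0 horner0.
apply: (@poly_eq0_inj _ m.+1 (fun i => (t i)%:R)).
- move=> i k /eqP; rewrite -subr_eq0; case: (eqVneq k i) => // ki.
  by rewrite (negPf (node_neq _ _ ki)).
- move=> k; rewrite hr (bigD1 k) //= lagrange_num_node eqxx big1 ?addr0 ?subrr //.
  by move=> i ik; rewrite lagrange_num_node eq_sym (negPf ik) mul0r.
rewrite (leq_trans (size_polyD _ _)) // geq_max size_polyN.
rewrite (leq_trans (size_scale_leq _ _)) //=.
apply: (leq_trans (size_sum _ _ _)); apply/bigmax_leqP => i _.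
by rewrite (leq_trans (size_scale_leq _ _)) // size_lagrange_poly.
Qed.

(** Converse of interpolation: values killed by the functionals come from one polynomial of degree
    at most [m]. This turns equal functional values in two windows into a polynomial relation. *)
Lemma lagrange_interpolant (v : 'I_m.+1 -> 'F_p) :
  exists q : {poly 'F_p}, (size q <= m.+1)%N /\
    forall (u : nat) (x : 'F_p),
      lagrange_den%:~R * x = \sum_i (lagrange_num i u)%:~R * v i ->
      q.[u%:R] = x.
Proof.
exists ((lagrange_den%:~R)^-1 *: \sum_i v i *: lagrange_poly i); split.
  rewrite (leq_trans (size_scale_leq _ _)) //.
  apply: (leq_trans (size_sum _ _ _)); apply/bigmax_leqP => i _.
  by rewrite (leq_trans (size_scale_leq _ _)) // size_lagrange_poly.
move=> u x hx; apply: (mulfI lagrange_den_neq0); rewrite hx.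
rewrite hornerZ mulVKf ?lagrange_den_neq0 // horner_sum.
by apply: eq_bigr => i _; rewrite hornerZ lagrange_polyE mulrC.
Qed.

End Lagrange.

(** * Curves with many points in a box *)

Definition on_curve (p : nat) (f : {poly 'F_p}) (s : 'F_p) (M x : nat) : Prop :=
  exists2 y : nat, (y < M)%N & (s + y%:R) ^+ 2 = f.[x%:R].

Lemma natr_Fp_neq0 p n : prime p -> (0 < n < p)%N -> n%:R != 0 :> 'F_p.
Proof.
move=> pp /andP[n0 np]; rewrite -(dvdn_pcharf (pchar_Fp pp)).
by apply/negP => /(dvdn_leq n0); lia.
Qed.

(** If [b = 2 s a] in [F_p], then [g = a (f - s^2)] takes on abscissae the values [a y^2 + b y], of
    size at most [B = 2 M^3 / q]. The inverse theorem makes [D] times the leading coefficient of [g]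
    vanish, although [D], [a] and the leading coefficient of [f] are nonzero modulo [p]. *)
Lemma no_small_ratio p m M Q (f : {poly 'F_p}) (s : 'F_p) (a b : int) :
  prime p -> (3 < m)%N -> size f = m.+1 -> (1 < Q)%N -> (0 < M < p)%N ->
  (Q ^ cW m <= M)%N -> (M ^ 3 <= Q * p)%N ->
  (M <= Q * cnt M (on_curve p f s M))%N ->
  a != 0 -> (`|a| * Q ^ (cW m + 2) <= M)%N ->
  (`|b| * Q ^ (cW m + 2) <= M ^ 2)%N ->
  b%:~R <> 2 * s * a%:~R.
Proof.
move=> pp m4 sf Q1 /andP[M0 Mp] QM M3 hX a0 ha hb eb.
set q := (Q ^ (cW m + 2))%N in ha hb.
have q0 : (0 < q)%N by rewrite expn_gt0; lia.
pose B := (2 * M ^ 3 %/ q)%N.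
have Bq : (B * (Q ^ cW m * (Q * Q)) <= 2 * M ^ 3)%N.
  by rewrite mulnn -expnD leq_trunc_div.
pose g := a%:~R *: (f - (s ^+ 2)%:P).
have ap : (`|a| < p)%N.
  by apply: leq_ltn_trans Mp; apply: leq_trans ha; rewrite leq_pmulr.
have aF : a%:~R != 0 :> 'F_p.
  by apply: contra a0 => /eqP /(@intr_Fp_inj0 p _ pp ap) ->.
have [| | |D [A [/andP[D0 DQ] hA eA]]] := weyl_inverse m p M Q B g pp Q1 _ QM.
- rewrite (leq_trans (size_scale_leq _ _)) // (leq_trans (size_polyD _ _)) //.
  by rewrite geq_max sf leqnn size_polyN (leq_trans (size_polyC_leq1 _)).
- have : (B * Q ^ cW m * (Q * Q) <= p * (Q * Q))%N.
    rewrite -mulnA (leq_trans Bq) //; apply: (@leq_trans (2 * (Q * p))).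
      by rewrite leq_mul2l.
    by rewrite (_ : p * (Q * Q) = Q * (Q * p))%N ?leq_mul2r ?Q1 ?orbT //; lia.
  by rewrite leq_pmul2r // muln_gt0; lia.
- apply: leq_trans hX _; rewrite leq_mul2l; apply/orP; right.
  apply: cnt_le => x _ [y yM ey]; exists (a * y%:Z ^+ 2 + b * y%:Z).
    rewrite leq_divRL //.
    have h1 : (`|a| * q * (y ^ 2) <= M * M ^ 2)%N.
      by apply: leq_mul => //; rewrite leq_exp2r // ltnW.
    have h2 : (`|b| * q * y <= M ^ 2 * M)%N by apply: leq_mul => //; rewrite ltnW.
    have e1 : (absz (a * y%:Z ^+ 2)%R = `|a| * y ^ 2)%N by rewrite abszM abszX.
    have e2 : (absz (b * y%:Z)%R = `|b| * y)%N by rewrite abszM.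
    apply: (@leq_trans ((`|a| * y ^ 2 + `|b| * y) * q)).
      by rewrite leq_mul2r; apply/orP; right; lia.
    apply: leq_trans (_ : M * M ^ 2 + M ^ 2 * M <= _)%N; last by lia.
    by rewrite mulnDl leq_add // mulnAC.
  rewrite hornerZ hornerD hornerN hornerC -ey rmorphD !rmorphM ?rmorphXn /= eb.
  by rewrite -pmulrn; ring.
(* Otherwise [M^4 <= |A| M^m <= Q^(cW m) B <= 2 M^3 / Q^2], which is impossible; [m > 3] enters
   here. *)
have A0 : A = 0.
  apply/eqP; rewrite -absz_eq0 -leqn0 leqNgt; apply/negP => A0.
  have h1 : (M ^ 4 <= Q ^ cW m * B)%N.
    apply: leq_trans hA; apply: (@leq_trans (M ^ m)); first by rewrite leq_pexp2l.
    by rewrite leq_pmull.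
  have h2 : (Q ^ cW m * B * (Q * Q) <= 2 * M ^ 3)%N.
    by rewrite [(Q ^ _ * B)%N]mulnC -mulnA.
  have h3 : (Q ^ cW m * B * 4 <= Q ^ cW m * B * (Q * Q))%N.
    rewrite leq_mul2l; apply/orP; right; nia.
  have h4 : (M ^ 3 <= M ^ 4)%N by rewrite leq_pexp2l.
  have h5 : (0 < M ^ 3)%N by rewrite expn_gt0 M0.
  lia.
have : D%:R * g`_m == 0 by rewrite -eA A0.
rewrite coefZ coefB coefC (_ : (m == 0)%N = false) ?subr0; last by lia.
have -> : f`_m = lead_coef f by rewrite /lead_coef sf.
rewrite !mulf_eq0 (negPf aF) lead_coef_eq0 -size_poly_eq0 sf !orbF.
apply/negP; apply: natr_Fp_neq0 => //; rewrite D0 /=.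
by apply: leq_ltn_trans Mp; apply: leq_trans QM.
Qed.

(** If [f = g^2], each abscissa has [y = g(x) - s] or [y = - g(x) - s] with [y < M], and one sign
    serves at least half of them. As [g] has degree [m./2 >= 2], so many values below [M] contradict
    the inverse theorem. *)
Lemma no_square p m M Q (f g : {poly 'F_p}) (s : 'F_p) :
  prime p -> (3 < m)%N -> size f = m.+1 -> (1 < Q)%N -> (0 < M < p)%N ->
  (Q ^ (2 * cW m./2 + 1) < M)%N -> (M ^ 3 <= Q * p)%N ->
  (M <= Q * cnt M (on_curve p f s M))%N -> f <> g ^+ 2.
Proof.
move=> pp m4 sf Q1 /andP[M0 Mp] QM M3 hX efg.
have sg : size g = m./2.+1.
  have h := size_exp g 2; rewrite -efg sf /= in h.
  have g0 : (0 < size g)%N by case: (size g) h => //; lia.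
  by rewrite h muln2 doubleK prednK.
set d := m./2 in QM sg; have d2 : (1 < d)%N by rewrite (half_leq m4).

have hQ2 : ((2 * Q) ^ cW d <= Q ^ (2 * cW d))%N.
  rewrite [in leqRHS]expnM; case: (cW d) => // c.
  by rewrite leq_exp2r // -mulnn leq_mul2r Q1 orbT.
have hQM : ((2 * Q) ^ cW d * Q < M)%N.
  by apply: leq_ltn_trans QM; rewrite expnD leq_mul2r hQ2 orbT.
pose h (i : 'I_2) := (-1) ^+ i *: g - s%:P.
have cover x : (x < M)%N -> on_curve p f s M x -> exists i, small p M (h i).[x%:R].
  move=> _ [y yM]; rewrite efg horner_exp => /eqP.
  have hy : (`|y%:Z| <= M)%N by exact: ltnW.
  rewrite eqf_sqr => /orP[] /eqP e.
    exists ord0; exists y%:Z => //.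
    by rewrite hornerD hornerN hornerC hornerZ expr0 mul1r -e addrC addKr.
  exists ord_max; exists y%:Z => //.
  by rewrite hornerD hornerN hornerC hornerZ expr1 mulN1r -e addrC addKr.
have [i hi] := pigeonhole_sum _ _ _ (cnt_cover _ _ _ _ cover).
have [| | | | |D [A [/andP[D0 DQ] hA eA]]] :=
  weyl_inverse d p M (2 * Q) M (h i) pp.
- lia.
- rewrite (leq_trans (size_polyD _ _)) // geq_max size_polyN.
  rewrite (leq_trans (size_polyC_leq1 _)) // andbT.
  by rewrite (leq_trans (size_scale_leq _ _)) // sg.
- apply: leq_trans (ltnW hQM); rewrite leq_pmulr //; lia.
- have : (Q * (M * (2 * Q) ^ cW d) <= Q * p)%N.
    apply: leq_trans M3; rewrite mulnC -mulnA (expnS M 2) leq_mul2l.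
    apply/orP; right; apply: leq_trans (ltnW hQM) _.
    by rewrite -mulnn leq_pmulr.
  by rewrite leq_pmul2l //; lia.
- by apply: leq_trans hX _; rewrite [(2 * Q)%N]mulnC -mulnA leq_mul2l hi orbT.
have A0 : A = 0.
  apply/eqP; rewrite -absz_eq0 -leqn0 leqNgt; apply/negP => A0.
  have h1 : (M * M <= (2 * Q) ^ cW d * M)%N.
    apply: leq_trans hA; apply: (@leq_trans (M ^ d)).
      by rewrite mulnn leq_pexp2l.
    by rewrite leq_pmull.
  have h2 : ((2 * Q) ^ cW d <= (2 * Q) ^ cW d * Q)%N by rewrite leq_pmulr //; lia.
  by move: h1; rewrite leq_pmul2r //; lia.
have : D%:R * (h i)`_d == 0 by rewrite -eA A0.
rewrite coefB coefC coefZ (_ : (d == 0)%N = false) ?subr0; last by lia.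
have -> : g`_d = lead_coef g by rewrite /lead_coef sg.
rewrite !mulf_eq0 signr_eq0 lead_coef_eq0 -size_poly_eq0 sg !orbF.
apply/negP; apply: natr_Fp_neq0 => //; rewrite D0 /=.
apply: leq_ltn_trans Mp; apply: leq_trans DQ _; apply: leq_trans (ltnW hQM).
by rewrite leq_pmulr //; lia.
Qed.

(* Index of the cell of length N / q containing a, for |a| <= Z * N. *)
Definition cell (Z N q : nat) (a : int) : nat :=
  (absz (a + (Z * N)%N%:Z)%R %/ (N %/ q))%N.

Lemma cell_le Z N q a : (0 < q <= N)%N -> (`|a| <= Z * N)%N ->
  (cell Z N q a <= 4 * Z * q)%N.
Proof.
move=> /andP[q0 qN] ha; have w0 : (0 < N %/ q)%N by rewrite divn_gt0.
have h : (N < (N %/ q).+1 * q)%N by rewrite ltn_ceil.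
have h2 : (N <= 2 * (q * (N %/ q)))%N.
  apply: (leq_trans (ltnW h)); rewrite [(q * _)%N]mulnC mulnA leq_mul2r.
  by apply/orP; right; lia.
have h3 : (absz (a + (Z * N)%N%:Z)%R <= Z * (2 * N))%N by lia.
have h4 : (Z * (2 * N) <= 4 * Z * q * (N %/ q))%N.
  rewrite (_ : 4 * Z * q * (N %/ q) = Z * (2 * (2 * (q * (N %/ q)))))%N; last by lia.
  by rewrite !leq_mul2l h2 !orbT.
by rewrite /cell -ltnS ltn_divLR // mulSn; lia.
Qed.

Lemma cell_inj Z N q a b : (0 < q <= N)%N ->
  (`|a| <= Z * N)%N -> (`|b| <= Z * N)%N ->
  cell Z N q a = cell Z N q b -> (absz (a - b)%R * q <= N)%N.
Proof.
move=> /andP[q0 qN] ha hb e; have w0 : (0 < N %/ q)%N by rewrite divn_gt0.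
apply: leq_trans (leq_trunc_div N q); rewrite leq_mul2r; apply/orP; right.
set w := (N %/ q)%N in e w0 *.
have ea := divn_eq (absz (a + (Z * N)%N%:Z)%R) w.
have eb := divn_eq (absz (b + (Z * N)%N%:Z)%R) w.
have ma := ltn_pmod (absz (a + (Z * N)%N%:Z)%R) w0.
have mb := ltn_pmod (absz (b + (Z * N)%N%:Z)%R) w0.
rewrite /cell -/w in e; rewrite e in ea; lia.
Qed.

Lemma cnt_blocks M L (P : nat -> Prop) : (0 < L)%N ->
  (cnt M P <= \sum_(k < M %/ L) cnt L (fun u => P (k * L + u)%N) + L)%N.
Proof.
move=> L0; rewrite cnt_sum -(big_mkord xpredT (fun i => nat_of_bool `[< P i >])).
rewrite (big_cat_nat (leq0n (M %/ L * L))) /=; last exact: leq_trunc_div.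
apply: leq_add.
  rewrite big_nat_mul big_mkord; apply: leq_sum => k _.
  rewrite cnt_sum -{1}[(k * L)%N]add0n big_addn mulSnr -addnC addnK big_mkord.
  by apply: leq_sum => u _; rewrite addnC.
apply: (@leq_trans (\sum_(M %/ L * L <= i < M) 1)); first by apply: leq_sum => i _; case: `[< _ >].
rewrite sum_nat_const_nat muln1 leq_subLR.
by rewrite addnC -mulSn ltnW // ltn_ceil.
Qed.

Lemma inj_enum_cnt L n (P : nat -> Prop) : (n <= cnt L P)%N ->
  exists2 u : {ffun 'I_n -> 'I_L}, injective u & forall i, P (u i).
Proof.
move=> h; exists [ffun i => enum_val (widen_ord h i)].
  by move=> i j; rewrite !ffunE => /enum_val_inj /(congr1 val) /= /val_inj.
by move=> i; rewrite ffunE; have := enum_valP (widen_ord h i); rewrite finset.in_set => /asboolP.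
Qed.

(** By contradiction, cutting [[0, M)] into windows of length [L]. A window with at least [n]
    abscissae is determined by the data [D k], so there are at most [Q^tau] of them, and the other
    windows hold too few abscissae for density [1 / Q]. *)
Lemma sparse_curve m : (3 < m)%N -> exists E : nat,
  forall Q M p (f : {poly 'F_p}) (s : 'F_p),
    prime p -> size f = m.+1 -> (1 < Q)%N -> (Q ^ E <= M < p)%N ->
    (M ^ 3 <= Q * p)%N -> (Q * cnt M (on_curve p f s M) < M)%N.
Proof.
(* Comparing two windows needs more than [4 m] points; [L = 4 n Q] below makes windows with fewer
   than [n] abscissae contribute at most [M / (4 Q)] in total. *)
move=> m4; pose n := (4 * m).+1.
pose l := (4 * n)%N.
(* [Q^e] is the precision at which functional values are compared, [Q^z] bounds the total size of
   the coefficients of a functional, and [Q^tau] bounds the number of values of [D]. The final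
   exponent exceeds those of all powers of [Q] that must stay below [M]. *)
pose e := (cW m + 2)%N.
pose z := (m.+2 + l.+1 * m * m.+1)%N.
pose tau := ((l.+1 + (3 + z + e) * 2) * n)%N.
exists (cW m + (2 * cW m./2 + 1) + e + l + tau + 10 + m)%N.
move=> Q M p f s pp sf Q1 /andP[QM Mp] M3; rewrite ltnNge; apply/negP => hX.
have pw a : (a < cW m + (2 * cW m./2 + 1) + e + l + tau + 10 + m)%N -> (Q ^ a < M)%N.
  by move=> ha; apply: leq_trans QM; rewrite ltn_exp2l.
have M0 : (0 < M)%N by rewrite (leq_ltn_trans _ (pw 0%N _)) //; lia.
have Mp' : (0 < M < p)%N by rewrite M0.
have M1Q : (m < M)%N.
  apply: leq_ltn_trans (pw m _); last by lia.
  by apply: leq_const_exp => //; apply: ltnW (ltn_expl _ _).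
have p2 : (2 < p)%N by lia.
pose q := (Q ^ e)%N; have q0 : (0 < q)%N by rewrite expn_gt0; lia.
have qM : (q <= M)%N by apply/ltnW/pw; lia.
have noratio a b : a != 0 -> (`|a| * q <= M)%N -> (`|b| * q <= M ^ 2)%N ->
    b%:~R <> 2 * s * a%:~R.
  by apply: (no_small_ratio p m M Q f s a b) => //; apply/ltnW/pw; lia.
have nosquare g : f <> g ^+ 2 by apply: (no_square p m M Q f g s) => //; apply/pw; lia.
pose L := (4 * n * Q)%N; have L0 : (0 < L)%N by rewrite /L !muln_gt0 (ltnW Q1).
have hL : (L <= Q ^ l.+1)%N.
  rewrite expnSr leq_mul2r; apply/orP; right.
  by apply: leq_const_exp => //; apply: ltnW (ltn_expl _ _).
have LM : (L <= M)%N by apply: (leq_trans hL); apply/ltnW/pw; lia.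
pose W := ((L ^ m) ^ m.+1)%N; pose Z := (m.+2 * W)%N.
have hZ : (Z <= Q ^ z)%N.
  apply: leq_mul_exp.
    by apply: leq_const_exp => //; apply: ltnW (ltn_expl _ _).
  by rewrite /W !expnM leq_exp2r // leq_exp2r //; lia.
(* One ordinate is chosen per abscissa, with default [0] off the curve. *)
have /choice[yv hyv] : forall x, exists y : nat, on_curve p f s M x ->
    (y < M)%N /\ (s + y%:R) ^+ 2 = f.[x%:R].
  move=> x.
  have [[y yM ey]|nx] := pselect (on_curve p f s M x); first by exists y.
  by exists 0%N.
pose pat k (u : {ffun 'I_n -> 'I_L}) := injective u /\
   forall i, on_curve p f s M (k * L + u i)%N.
have /choice[uu huu] : forall k, exists v, (exists u, pat k u) -> pat k v.
  move=> k.
  have [[u hu]|nk] := pselect (exists u, pat k u); first by exists u.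
  by exists [ffun=> Ordinal L0].
have mn : (m.+1 <= n)%N by rewrite /n; lia.
(* The first [m.+1] pattern points are the nodes; [lam k Y j] is the scaled error in interpolating
   [Y] at the point of index [j] from the nodes. *)
pose t k (i : 'I_m.+1) : nat := uu k (widen_ord mn i).
pose lam k (Y : nat -> int) (j : 'I_n) : int :=
  lagrange_den m (t k) * Y (k * L + uu k j)%N -
  \sum_i lagrange_num m (t k) i (uu k j) * Y (k * L + t k i)%N.
pose Y1 x : int := (yv x)%:Z; pose Y2 x : int := (yv x)%:Z ^+ 2.
have lam_le k Y N j : pat k (uu k) ->
    (forall x, on_curve p f s M x -> (absz (Y x) <= N)%N) ->
    (absz (lam k Y j) <= Z * N)%N.
  move=> [uinj upat] YN.
  have tL i : (t k i < L)%N by exact: ltn_ord.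
  have h1 : (absz (lagrange_den m (t k) * Y (k * L + uu k j)%N)%R <= W * N)%N.
    rewrite abszM leq_mul ?YN //; exact: lagrange_den_le.
  have h2 : (absz (\sum_i lagrange_num m (t k) i (uu k j) * Y (k * L + t k i)%N)%R
      <= m.+1 * (W * N))%N.
    rewrite -[X in (_ <= X * _)%N]card_ord -sum_nat_const.
    elim/big_rec2: _ => // i x y _ h.
    apply: (@leq_trans (absz (lagrange_num m (t k) i (uu k j) * Y (k * L + t k i)%N)%R + absz y)%N).
      by lia.
    apply: leq_add => //.
    rewrite abszM leq_mul ?YN //; first exact: lagrange_num_le.
    exact: upat.
  rewrite /lam /Z mulSn mulnDl -[(m.+1 * W * N)%N]mulnA; lia.
have lam1 k j : pat k (uu k) -> (absz (lam k Y1 j) <= Z * M)%N.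
  by move=> hk; apply: lam_le => // x /hyv[/ltnW].
have lam2 k j : pat k (uu k) -> (absz (lam k Y2 j) <= Z * M ^ 2)%N.
  move=> hk; apply: lam_le => // x /hyv[/ltnW h _].
  by rewrite /Y2 abszX leq_exp2r.
pose C := (4 * Z * q)%N.
pose D k : {ffun 'I_n -> 'I_L} * {ffun 'I_n -> 'I_C.+1 * 'I_C.+1} :=
  (uu k, [ffun j => (inord (cell Z M q (lam k Y1 j)),
                     inord (cell Z (M ^ 2) q (lam k Y2 j)))]).
pose K := (M %/ L)%N.
have tinj k : pat k (uu k) -> injective (t k).
  by move=> [uinj _] i j /val_inj /uinj /(congr1 val) /= /val_inj.
have Lp : (L <= p)%N by lia.
have lamE k j : (lam k Y1 j)%:~R = (lagrange_den m (t k))%:~R * (yv (k * L + uu k j)%N)%:R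
    - \sum_i (lagrange_num m (t k) i (uu k j))%:~R * (yv (k * L + t k i)%N)%:R :> 'F_p.
  rewrite /lam rmorphB rmorphM rmorph_sum; congr (_ - _).
  by apply: eq_bigr => i _; rewrite rmorphM.
(* The functional kills constants and [f], of degree [m]; applied to [(s + y)^2 = f] it leaves
   [lam k Y2 j + 2 s lam k Y1 j = 0]. *)
have lamF k j : pat k (uu k) ->
   (lam k Y2 j)%:~R = - (2 * s * (lam k Y1 j)%:~R) :> 'F_p.
  move=> hk; have [_ upat] := hk.
  have tL i : (t k i < L)%N by exact: ltn_ord.
  have interp := lagrange_interpolation m L (t k) (tinj _ hk) tL p pp Lp.
  set y : 'F_p := (yv (k * L + uu k j)%N)%:R.
  pose c i : 'F_p := (lagrange_num m (t k) i (uu k j))%:~R.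
  pose yt i : 'F_p := (yv (k * L + t k i)%N)%:R.
  set dn : 'F_p := (lagrange_den m (t k))%:~R in interp.
  have e1 : dn * (s + y) ^+ 2 = \sum_i c i * (s + yt i) ^+ 2.
    have fE x : (f \Po ('X + ((k * L)%N%:R)%:P)).[x%:R] = f.[(k * L + x)%N%:R].
      by rewrite horner_comp hornerD hornerX hornerC natrD addrC.
    have := interp (f \Po ('X + ((k * L)%N%:R)%:P)) (uu k j) _.
    rewrite size_comp_XaddC sf fE => /(_ (leqnn _)).
    have [_ <-] := hyv _ (upat j); move=> ->.
    by apply: eq_bigr => i _; rewrite fE; have [_ <-] := hyv _ (upat (widen_ord mn i)).
  have e0 : dn = \sum_i c i.
    have := interp 1 (uu k j) _; rewrite size_poly1 hornerC mulr1 => -> //.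
    by apply: eq_bigr => i _; rewrite hornerC mulr1.
  have e2 : \sum_i c i * (s + yt i) ^+ 2 =
      s ^+ 2 * dn + 2 * s * (\sum_i c i * yt i) + \sum_i c i * yt i ^+ 2.
    rewrite e0 !mulr_sumr -!big_split; apply: eq_bigr => i _ /=; ring.
  have l2 : (lam k Y2 j)%:~R = dn * y ^+ 2 - \sum_i c i * yt i ^+ 2.
    rewrite /lam rmorphB rmorphM rmorph_sum rmorphXn; congr (_ - _).
    by apply: eq_bigr => i _; rewrite rmorphM rmorphXn.
  rewrite lamE l2; move: e1; rewrite e2 -/dn -/y.
  move: (\sum_i c i * yt i) (\sum_i c i * yt i ^+ 2) => S1 S2 e1.
  have -> : S2 = dn * (s + y) ^+ 2 - (s ^+ 2 * dn + 2 * s * S1).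
    by rewrite e1 addrC addKr.
  ring.
have Dinj : {in [set k : 'I_K | `[< exists u, pat k u >]] &, injective (fun k : 'I_K => D k)}.
  move=> k k'; rewrite !finset.in_set => /asboolP/huu hk /asboolP/huu hk' [eu ec].
  have et : t k' = t k by rewrite /t eu.
  have q1 : (0 < q <= M)%N by rewrite q0.
  have q2 : (0 < q <= M ^ 2)%N by rewrite q0 (leq_trans qM) // -mulnn leq_pmulr.
  (* Distinct values in equal cells would give [a <> 0] and [b = 2 s a], both too small for
     [noratio]. *)
  have elam j : lam k Y1 j = lam k' Y1 j.
    have [/eqP|ne] := eqVneq (lam k Y1 j - lam k' Y1 j) 0; first by rewrite subr_eq0 => /eqP.
    have := congr1 (fun h : {ffun 'I_n -> 'I_C.+1 * 'I_C.+1} => h j) ec.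
    rewrite !ffunE => -[] /(congr1 val) + /(congr1 val).
    rewrite /= !inordK ?ltnS ?cell_le ?lam1 ?lam2 // => c1 c2.
    have h1 := cell_inj Z M q _ _ q1 (lam1 _ j hk) (lam1 _ j hk') c1.
    have h2 := cell_inj Z (M ^ 2) q _ _ q2 (lam2 _ j hk') (lam2 _ j hk) (esym c2).
    have := noratio _ _ ne h1 h2; case.
    by rewrite intrB [in RHS]intrB !lamF //; ring.
  apply/eqP/negP => /negP kk'.
  have tL i : (t k i < L)%N by exact: ltn_ord.
  (* All functionals agree in the two windows, so the difference of the ordinates is a polynomial
     [g] in the offset; this makes [f] a square. *)
  have [g [sg hg]] := lagrange_interpolant m L (t k) (tinj _ hk) tL p pp Lp
    (fun i => (yv (k * L + t k i)%N)%:R - (yv (k' * L + t k i)%N)%:R).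
  have small_neq x y : (x < p)%N -> (y < p)%N -> x != y -> x%:R != y%:R :> 'F_p.
    move=> xp yp; apply: contra => /eqP exy.
    have : (x%:Z - y%:Z)%:~R = 0 :> 'F_p by rewrite rmorphB /= -!pmulrn exy subrr.
    by move/(@intr_Fp_inj0 p _ pp); lia.
  have kM (i : 'I_K) : (i * L < p)%N.
    apply: leq_ltn_trans Mp; apply: leq_trans (leq_trunc_div M L).
    by rewrite leq_mul2r ltnW ?orbT.
  have [|||||||||||g' /nosquare //] := @square_of_collision _ m n f g
    ((k * L)%N%:R) ((k' * L)%N%:R) (fun i => (uu k i)%:R)
    (fun i => s + (yv (k * L + uu k i)%N)%:R)
    (fun i => s + (yv (k' * L + uu k i)%N)%:R).
  - by lia.
  - by apply: natr_Fp_neq0 => //; lia.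
  - by apply: natr_Fp_neq0 => //; lia.
  - by [].
  - by rewrite /n.
  - move=> i j /eqP; apply: contraTeq => ij; apply: small_neq.
    + by apply: leq_trans Lp.
    + by apply: leq_trans Lp.
    + by have [uinj _] := hk; apply: contra ij => /eqP/val_inj/uinj ->.
  - by apply: small_neq => //; rewrite eqn_pmul2r.
  - by [].
  - move=> i; have [_ up] := hk; have [_ ->] := hyv _ (up i).
    by rewrite natrD addrC.
  - move=> i; have [_ up] := hk'; rewrite eu; have [_ ->] := hyv _ (up i).
    by rewrite natrD addrC.
  move=> i; apply/esym; rewrite opprD addrACA subrr add0r; apply: hg.
  have aux (a b v w : 'F_p) : a - v = b - w -> a - b = v - w.
    by move=> h; have -> : a = b - w + v by [rewrite -h subrK]; ring.
  have := lamE k i; rewrite elam lamE et -eu => /esym/aux.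
  rewrite -mulrBr => ->.
  by rewrite -sumrB; apply: eq_bigr => j _; rewrite mulrBr.
have hgood : (cnt K (fun k => exists u, pat k u) <= Q ^ tau)%N.
  apply: leq_trans (@leq_card_in _ _ _ _ Dinj) _.
  rewrite card_prod !card_ffun card_prod !card_ord -expnMn.
  have hC : (C.+1 <= Q ^ (3 + z + e))%N.
    apply: (@leq_trans (8 * Z * q)%N).
      have : (0 < 4 * Z * q)%N by rewrite !muln_gt0 q0 !expn_gt0 L0.
      rewrite /C; lia.
    by do 2! apply: leq_mul_exp => //; apply: leq_const_exp.
  have : (L * (C.+1 * C.+1) <= Q ^ (l.+1 + (3 + z + e) * 2))%N.
    by apply: leq_mul_exp => //; rewrite muln2 -addnn leq_mul_exp.
  by rewrite /tau expnM leq_exp2r.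
have hcnt : (cnt M (on_curve p f s M) <= K * n + L * Q ^ tau + L)%N.
  apply: leq_trans (cnt_blocks _ L _ L0) _; rewrite leq_add2r.
  apply: (@leq_trans (K * n + L * cnt K (fun k => exists u, pat k u))%N); last first.
    by rewrite leq_add2l leq_mul2l hgood orbT.
  rewrite cnt_sum big_distrr /= -[X in (_ <= X * _ + _)%N]card_ord -sum_nat_const.
  rewrite -big_split; apply: leq_sum => k _ /=.
  (* A window with at least [n] abscissae has a pattern and is bounded trivially by [L]; any other
     counts for less than [n]. *)
  have [/inj_enum_cnt [u uinj hu]|] := leqP n (cnt L (fun u => on_curve p f s M (k * L + u)%N)).
    have -> : `[< exists u, pat k u >] by apply/asboolP; exists u.
    by rewrite muln1 (leq_trans (cnt_leN _ _)) // leq_addl.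
  by move=> h; rewrite (leq_trans (ltnW h)) // leq_addr.
have KL : (K * L <= M)%N by exact: leq_trunc_div.
have hKn : (4 * (Q * (K * n)) <= M)%N.
  by apply: leq_trans KL; rewrite /L; lia.
have hT : (8 * (Q * (L * Q ^ tau)) < M)%N.
  apply: (@leq_ltn_trans (Q ^ (3 + (1 + (l.+1 + tau))))); last by apply: pw; lia.
  apply: leq_mul_exp; first exact: leq_const_exp.
  by do 2! apply: leq_mul_exp => //; rewrite ?expn1.
have hT0 : (L <= L * Q ^ tau)%N by rewrite leq_pmulr // expn_gt0; lia.
have hQT : (Q * L <= Q * (L * Q ^ tau))%N by rewrite leq_mul2l hT0 orbT.
have := leq_mul (leqnn Q) hcnt.
rewrite (mulnDr Q (_ + _) L) (mulnDr Q (K * n)) => h; have := leq_trans hX h; move: hKn hT hQT.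
move: (Q * (K * n))%N (Q * (L * Q ^ tau))%N (Q * L)%N => x1 x2 x3.
by clear -M0; lia.
Qed.

(** * The mean value bound *)

Lemma sqr_sum_le (U : finType) (N : U -> nat) :
  ((\sum_u N u) ^ 2 <= #|U| * \sum_u N u ^ 2)%N.
Proof.
rewrite -(leq_pmul2l (isT : 0 < 2)%N).
have -> : (2 * (\sum_u N u) ^ 2 = \sum_u \sum_v 2 * (N u * N v))%N.
  rewrite -mulnn big_distrl big_distrr; apply: eq_bigr => u _ /=.
  by rewrite !big_distrr.
apply: (@leq_trans (\sum_u \sum_v (N u ^ 2 + N v ^ 2))%N).
  by apply: leq_sum => u _; apply: leq_sum => v _; exact: nat_Cauchy.
under eq_bigr => u _ do rewrite big_split sum_nat_const.
by rewrite big_split sum_nat_const -big_distrr /= addnn -mul2n.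
Qed.

(** Cauchy-Schwarz over the fibres of [psi], whose squared sizes add up to the number of colliding
    pairs. *)
Lemma collision_count (T U : finType) (A : {set T}) (psi : T -> U) :
  (#|A| ^ 2 <= #|U| *
    #|[set x : T * T | [&& x.1 \in A, x.2 \in A & psi x.1 == psi x.2]]|)%N.
Proof.
pose fib u := [set x in A | psi x == u].
have -> : #|A| = (\sum_u #|fib u|)%N.
  rewrite -sum1_card (partition_big psi xpredT) //=; apply: eq_bigr => u _.
  by rewrite -sum1_card; apply: eq_bigl => x; rewrite finset.in_set.
apply: leq_trans (sqr_sum_le _ _) _; rewrite leq_mul2l; apply/orP; right.
rewrite -sum1_card (partition_big (fun x => psi x.1) xpredT) //=.
apply: leq_sum => u _; rewrite -mulnn -cardsX -sum1_card.
rewrite [leqRHS](eq_bigl (fun x => x \in finset.setX (fib u) (fib u))) // => -[x y].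
rewrite finset.in_setX !finset.in_set /=.
case: (x \in A) => //=; case: (y \in A) => //=; last by rewrite andbF.
by apply/andP/andP => -[/eqP-> /eqP->].
Qed.

Lemma sum_le_const k B (F : 'I_k -> nat) : (forall i, F i <= B)%N ->
  (\sum_i F i <= k * B)%N.
Proof.
by move=> FB; rewrite -[k in leqRHS]card_ord -sum_nat_const; apply: leq_sum.
Qed.

(** Here [f] has degree [m.+1]. Tuples of abscissae are classified by the power sums below the top
    one, the sums of [y] and [y^2], and the quotient by [p] of the top power sum. The summed curve
    equations fix the latter modulo [p], so in a collision all power sums agree and [vinogradov_J]
    counts it. *)
Lemma mean_value_count p m k M (f : {poly 'F_p}) (s : 'F_p) :
  prime p -> size f = m.+2 ->
  (cnt M (on_curve p f s M) ^ (2 * k) <=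
   (\prod_(j < m) (k * M ^ j.+1).+1) *
     ((k * M).+1 * (k * M ^ 2).+1 * (k * M ^ m.+1 %/ p).+1) *
   vinogradov_J k m.+1 M)%N.
Proof.
move=> pp sf; set X := on_curve p f s M.
have /choice[yv hyv] : forall x, exists y : nat, X x ->
    (y < M)%N /\ (s + y%:R) ^+ 2 = f.[x%:R].
  move=> x; have [[y yM ey]|nx] := pselect (X x); first by exists y.
  by exists 0%N.
pose A : {set {ffun 'I_k -> 'I_M}} := [set x : {ffun 'I_k -> 'I_M} | [forall i, `[< X (x i) >]]].
have cA : #|A| = (cnt M X ^ k)%N.
  rewrite -[in RHS](card_ord k) -card_ffun_on; apply: eq_card => x; rewrite finset.in_set.
  by apply/forallP/ffun_onP => h i; have := h i; rewrite finset.in_set.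
pose z j (x : {ffun 'I_k -> 'I_M}) := (\sum_i (x i).+1 ^ j.+1)%N.
(* Capping by [M] keeps these sums in range for every tuple and changes nothing on abscissae. *)
pose y1 (x : {ffun 'I_k -> 'I_M}) := (\sum_i minn M (yv (x i)))%N.
pose y2 (x : {ffun 'I_k -> 'I_M}) := (\sum_i minn M (yv (x i)) ^ 2)%N.
have zle j x : (z j x <= k * M ^ j.+1)%N.
  by apply: sum_le_const => i; rewrite leq_exp2r.
have y1le x : (y1 x <= k * M)%N.
  by apply: sum_le_const => i; rewrite geq_minl.
have y2le x : (y2 x <= k * M ^ 2)%N.
  by apply: sum_le_const => i; rewrite leq_exp2r // geq_minl.
pose U := ({dffun forall j : 'I_m, 'I_(k * M ^ j.+1).+1} *
  ('I_(k * M).+1 * 'I_(k * M ^ 2).+1 * 'I_(k * M ^ m.+1 %/ p).+1))%type.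
pose psi x : U := ([ffun j : 'I_m => inord (z j x) : 'I_(k * M ^ j.+1).+1],
   (inord (y1 x), inord (y2 x), inord (z m x %/ p))).
have cU : #|{: U}| = ((\prod_(j < m) (k * M ^ j.+1).+1) *
     ((k * M).+1 * (k * M ^ 2).+1 * (k * M ^ m.+1 %/ p).+1))%N.
  rewrite !card_prod !card_ord card_dep_ffun; congr (_ * _)%N.
  rewrite foldrE big_map big_enum /=; apply: eq_bigr => j _; by rewrite card_ord.
rewrite mulnC expnM -cA -cU; apply: leq_trans (collision_count _ _ _ psi) _.
rewrite leq_mul2l; apply/orP; right; apply: subset_leq_card; apply/fintype.subsetP.
move=> -[x x']; rewrite !finset.in_set /= => /and3P[/forallP xA /forallP xA' /eqP[e1 e2 e3 e4]].
have ez j : (j < m)%N -> z j x = z j x'.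
  move=> jm; have := congr1 (fun h : {dffun forall j : 'I_m, 'I_(k * M ^ j.+1).+1} => nat_of_ord (h (Ordinal jm))) e1.
  by rewrite !ffunE !inordK ?ltnS ?zle.
have ey1 : y1 x = y1 x'.
  by move/(congr1 val): e2; rewrite /= !inordK ?ltnS.
have ey2 : y2 x = y2 x'.
  by move/(congr1 val): e3; rewrite /= !inordK ?ltnS.
have ezm : (z m x %/ p = z m x' %/ p)%N.
  by move/(congr1 val): e4; rewrite /= !inordK ?ltnS ?leq_div2r ?zle.
(* [vinogradov_J] uses the variables [x + 1] in [[1, M]], so [f] is rewritten as a polynomial in
   [x + 1]. *)
pose h := f \Po ('X + (-1)%:P).
have hE (u : {ffun 'I_k -> 'I_M}) : (forall i, X (u i)) ->
    k%:R * s ^+ 2 + 2 * s * (y1 u)%:R + (y2 u)%:R =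
    k%:R * h`_0 + \sum_(j < m.+1) h`_j.+1 * (z j u)%:R.
  move=> uX; transitivity (\sum_(i < k) h.[(u i).+1%:R]).
    have -> : k%:R * s ^+ 2 = \sum_(i < k) s ^+ 2.
      by rewrite sumr_const card_ord mulr_natl.
    rewrite /y1 /y2 !natr_sum mulr_sumr -!big_split.
    apply: eq_bigr => i _ /=; rewrite horner_comp hornerD hornerX hornerC.
    rewrite -[(u i).+1%:R]natr1 addrK; have [/ltnW yM <-] := hyv _ (uX i).
    by rewrite (minn_idPr yM) natrX; ring.
  have sh : (size h <= m.+2)%N by rewrite size_comp_XaddC sf.
  rewrite (eq_bigr (fun i : 'I_k => h`_0 +
      \sum_(j < m.+1) h`_j.+1 * ((u i).+1 ^ j.+1)%N%:R)); last first.
    move=> i _; rewrite (horner_coef_wide _ sh) big_ord_recl expr0 mulr1.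
    by congr (_ + _); apply: eq_bigr => j _; rewrite natrX.
  rewrite big_split /= sumr_const card_ord; congr (_ + _); first by rewrite mulr_natl.
  rewrite exchange_big; apply: eq_bigr => j _ /=.
  by rewrite natr_sum mulr_sumr.
have hm : h`_m.+1 != 0.
  rewrite coef_comp_XaddC_top ?sf //.
  by rewrite (_ : f`_m.+1 = lead_coef f) ?lead_coef_eq0 -?size_poly_eq0 /lead_coef sf.
have /hE ex : forall i, X (x i) by move=> i; apply/asboolP.
have /hE ex' : forall i, X (x' i) by move=> i; apply/asboolP.
have ezF : (z m x)%:R = (z m x')%:R :> 'F_p.
  move: ex; rewrite ey1 ey2 ex' => /addrI; rewrite !big_ord_recr /=.
  rewrite (eq_bigr (fun j : 'I_m => h`_j.+1 * (z j x)%:R)) => [|j _]; last by rewrite ez.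
  by move=> /addrI/(mulfI hm).
have zmod : (z m x %% p = z m x' %% p)%N.
  by move/(congr1 (fun a : 'F_p => nat_of_ord a)): ezF; rewrite !val_Fp_nat.
have zm : z m x = z m x' by rewrite (divn_eq (z m x) p) zmod ezm -divn_eq.
apply/forallP => j; apply/eqP; rewrite -/(z j x) -/(z j x').
by have := ltn_ord j; rewrite ltnS leq_eqVlt => /orP[/eqP->|/ez].
Qed.

(** Up to constants, the lower power sums have [M^(1 + ... + (m - 1))] values, the sums of [y] and
    [y^2] have [M^3], and the quotient by [p] has [(M^m + p) / p]. *)
Lemma mean_value_bound p m k M (f : {poly 'F_p}) (s : 'F_p) :
  prime p -> size f = m.+1 -> (0 < m)%N -> (0 < k)%N -> (0 < M)%N ->
  (cnt M (on_curve p f s M) ^ (2 * k) * p <=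
   (2 * k) ^ m.+2 * M ^ ('C(m, 2) + 3) * (M ^ m + p) * vinogradov_J k m M)%N.
Proof.
case: m => // m pp sf _ k0 M0.
have p0 := prime_gt0 pp.
have h1 a : ((k * M ^ a).+1 <= 2 * k * M ^ a)%N.
  have : (0 < k * M ^ a)%N by rewrite muln_gt0 k0 expn_gt0 M0.
  rewrite -mulnA; lia.
have hprod : (\prod_(j < m) (k * M ^ j.+1).+1 <= (2 * k) ^ m * M ^ 'C(m.+1, 2))%N.
  apply: (@leq_trans (\prod_(j < m) (2 * k * M ^ j.+1))%N).
    by apply: leq_prod => j _.
  rewrite big_split prod_nat_const card_ord -expn_sum /= leq_mul2l.
  by rewrite -bin2_sum big_nat_recl // big_mkord add0n leqnn orbT.
have hdiv : ((k * M ^ m.+1 %/ p).+1 * p <= 2 * k * (M ^ m.+1 + p))%N.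
  have := leq_trunc_div (k * M ^ m.+1) p.
  have : (p <= k * p)%N by rewrite leq_pmull.
  rewrite mulSn mulnDr -!mulnA; lia.
have := mean_value_count p m k M f s pp sf.
rewrite -(leq_pmul2r p0) => /leq_trans; apply.
rewrite mulnAC leq_mul2r; apply/orP; right.
have assoc (a b c d e : nat) : (a * (b * c * d) * e = a * (b * (c * (d * e))))%N.
  by rewrite !mulnA.
rewrite assoc; have e1 := h1 1%N; rewrite expn1 in e1.
apply: leq_trans (leq_mul hprod (leq_mul e1 (leq_mul (h1 2) hdiv))) _.
rewrite -(addn3 m) (expnD (2 * k)) (expnD M 'C(m.+1, 2) 3) (expnSr (2 * k) 2) (expnSr M 2).
by apply: eq_leq; rewrite -(mulnn (2 * k)); ring.
Qed.

(** * Asymptotics *)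

(** Each abscissa carries at most two ordinates: [h] tells whether a square root equals that of a
    fixed point [x0] or is its opposite, and residues determine ordinates as [M < p]. *)
Lemma curve_points_le p (f : {poly 'F_p}) M R S : prime p -> (M < p)%N ->
  (curve_points f M R S <=
   2 * cnt M (on_curve p (f \Po ('X + ((R + 1)%:~R)%:P)) ((S + 1)%:~R) M))%N.
Proof.
move=> pp Mp; rewrite /curve_points -sum1_card.
set g := f \Po _; set s := (S + 1)%:~R.
have gE (i : 'I_M) : f.[(R + 1 + (i : nat)%:Z)%:~R] = g.[i%:R].
  by rewrite horner_comp hornerD hornerX hornerC rmorphD addrC.
have sE (j : 'I_M) : (S + 1 + (j : nat)%:Z)%:~R = s + j%:R :> 'F_p.
  by rewrite rmorphD.
rewrite (partition_big (fun x => x.1) xpredT) //= cnt_sum big_distrr /=.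
apply: leq_sum => i _; rewrite sum1dep_card.
set T := [set _ | _]; have [->|[x0 hx0]] := set_0Vmem T; first by rewrite cards0.
have hT x : x \in T -> (s + x.2%:R) ^+ 2 = g.[i%:R] /\ x.1 = i.
  by rewrite !finset.in_set sE gE => /andP[/eqP -> /eqP <-].
have [e0 _] := hT _ hx0.
have -> : `[< on_curve p g s M i >].
  by apply/asboolP; exists x0.2.
pose h (x : 'I_M * 'I_M) := s + x.2%:R == s + x0.2%:R.
rewrite muln1 -card_bool; apply: (@leq_card_in _ _ h) => x y /hT[ex x1] /hT[ey y1] hxy.
have exy : s + x.2%:R = s + y.2%:R.
  have : (s + x.2%:R) ^+ 2 == (s + x0.2%:R) ^+ 2 by rewrite ex e0.
  have : (s + y.2%:R) ^+ 2 == (s + x0.2%:R) ^+ 2 by rewrite ey e0.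
  move: hxy; rewrite /h !eqf_sqr; case: eqP => [->|_]; case: eqP => [->|_] //= _.
  by move=> /eqP -> /eqP ->.
case: x y {hxy ex ey} x1 y1 exy => [x1 x2] [y1 y2] /= -> -> /addrI e.
congr (_, _); apply/val_inj => /=.
have : (x2%:Z - y2%:Z)%:~R = 0 :> 'F_p by rewrite rmorphB /= -!pmulrn e subrr.
have := ltn_ord x2; have := ltn_ord y2 => h1 h2.
by move/(@intr_Fp_inj0 p _ pp); lia.
Qed.

(** For the largest [Q] with [Q^E <= M], one has [M < (Q + 1)^E <= Q^(2 E)]. *)
Lemma nat_root E B M : (0 < E)%N -> (1 < B)%N -> (B ^ E <= M)%N ->
  exists Q : nat, [/\ (B <= Q)%N, (Q ^ E <= M)%N & (M < Q ^ (2 * E))%N].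
Proof.
move=> E0 B1 BM; pose P Q := (Q ^ E <= M)%N.
have exP : exists Q, P Q by exists B.
have ubP Q : P Q -> (Q <= M)%N.
  by apply: leq_trans; case: Q => // Q; rewrite -{1}[Q.+1]expn1 leq_pexp2l.
case: (ex_maxnP exP ubP) => Q QE hQ; exists Q; split => //; first exact: hQ.
have BQ : (B <= Q)%N by exact: hQ.
rewrite ltnNge; apply/negP => h; have : (Q.+1 <= Q)%N.
  apply: hQ; apply: leq_trans h; rewrite expnM leq_exp2r //; nia.
by rewrite ltnn.
Qed.

Lemma le_powR_root (K : realType) (n : nat) (x y : K) :
  (0 < n)%N -> 0 <= x -> x ^+ n <= y -> x <= y `^ (n%:R^-1).
Proof.
move=> n0 x0 xy; have nK : n%:R != 0 :> K by rewrite pnatr_eq0 -lt0n.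
have y0 : 0 <= y by apply: le_trans xy; exact: exprn_ge0.
have -> : x = (x ^+ n) `^ (n%:R^-1).
  by rewrite -powR_mulrn // -powRrM mulfV // powRr1.
by apply: ge0_ler_powR => //; rewrite ?invr_ge0 ?nnegrE ?exprn_ge0.
Qed.

(* The logarithm of a constant C is absorbed in the exponent. *)
Definition slack (K : realType) (C : K) (o : nat -> K) (k M : nat) : K :=
  (`|o M| + ln C / ln M%:R) / (2 * k%:R).

Lemma slack_ge0 (K : realType) (C : K) o k M : 1 <= C -> (1 < M)%N ->
  0 <= slack K C o k M.
Proof.
move=> C1 M1; rewrite divr_ge0 ?mulr_ge0 ?ler0n // addr_ge0 ?normr_ge0 //.
by rewrite divr_ge0 ?ln_ge0 // ler1n ltnW.
Qed.

Lemma slack_small (K : realType) (C : K) o k (eps : K) : 1 <= C -> (0 < k)%N ->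
  (o n @[n --> \oo] --> (0 : K))%classic -> 0 < eps ->
  (\forall M \near \oo, slack K C o k M < eps)%classic.
Proof.
move=> C1 k0 oo eps0; have k0' : 0 < k%:R :> K by rewrite ltr0n.
near=> M.
rewrite ltr_pdivrMr ?mulr_gt0 //.
have h1 : `|o M| < eps * k%:R.
  by near: M; apply: cvgr0_norm_lt; [exact: oo | by rewrite mulr_gt0].
have M1 : (1 < M)%N by near: M; exact: nbhs_infty_gt.
have l0 : 0 < ln (M%:R : K) by rewrite ln_gt0 // ltr1n.
have h2 : ln C / ln (M%:R : K) < eps * k%:R.
  rewrite ltr_pdivrMr // -ltr_pdivrMl ?mulr_gt0 //.
  rewrite -ltr_expR lnK ?posrE ?ltr0n ?(ltnW M1) //.
  by near: M; exact: nbhs_infty_gtr.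
by lra.
Unshelve. all: by end_near. Qed.

Lemma powR_slack (K : realType) (C : K) o k M : 1 <= C -> (1 < M)%N ->
  (0 < k)%N ->
  C * M%:R `^ o M <= (M%:R `^ slack K C o k M) ^+ (2 * k).
Proof.
move=> C1 M1 k0; have k0' : k%:R != 0 :> K by rewrite pnatr_eq0 -lt0n.
have M0 : (0 : K) < M%:R by rewrite ltr0n ltnW.
have C0 : 0 < C by exact: lt_le_trans C1.
have l0 : 0 < ln (M%:R : K) by rewrite ln_gt0 // ltr1n.
rewrite -powR_mulrn ?powR_ge0 // -powRrM natrM divfK; last first.
  by rewrite mulf_neq0 // pnatr_eq0.
rewrite powRD; last by rewrite (gt_eqF M0) implybT.
have -> : M%:R `^ (ln C / ln M%:R) = C.
  by rewrite /powR gt_eqF // divfK ?gt_eqF // lnK.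
rewrite mulrC ler_wpM2r ?(ltW C0) //.
by rewrite ler_powR ?ler_norm // ler1n ltnW.
Qed.

(** Moves a factor [M^om] into the exponent of another base, later [a = M^3 / p]. *)
Lemma powR_shift (K : realType) (a M om : K) : 0 < a -> a != 1 -> 0 < M ->
  a `^ (om * ln M / ln a) = M `^ om.
Proof.
move=> a0 a1 M0; rewrite /powR !gt_eqF // divfK //.
by rewrite ln_eq0.
Qed.

Lemma bin2_natr (K : realType) m : ('C(m, 2))%:R = (m%:R * (m%:R - 1)) / 2 :> K.
Proof.
case: m => [|m]; first by rewrite bin0n mul0r mul0r.
have : ('C(m.+1, 2) * 2 = m.+1 * m)%N by rewrite mulnC -mul_bin_diag bin1.
move=> /(congr1 (fun n : nat => n%:R : K)); rewrite !natrM => h.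
by rewrite -[m.+1%:R]natr1 addrK natr1 -h mulfK // pnatr_eq0.
Qed.

(** The exponents of [M] add up to [m (m - 1) / 2 + 3 + 2 k - m (m + 1) / 2 = 2 k + 3 - m]. The
    doubled count anticipates two ordinates per abscissa. *)
Lemma mean_value_real (K : realType) m k p M (f : {poly 'F_p}) (s : 'F_p)
    (C oM : K) : prime p -> size f = m.+1 -> (0 < m)%N -> (0 < k)%N ->
  (1 < M)%N -> 0 <= C ->
  (vinogradov_J k m M)%:R <= C * M%:R `^ ((2 * k)%:R - (m * m.+1)%:R / 2 + oM) ->
  (2 * (cnt M (on_curve p f s M))%:R) ^+ (2 * k) <=
    2 ^+ (2 * k) * (2 * k)%:R ^+ m.+2 * C * M%:R `^ oM * M%:R ^+ (2 * k) *
      (M%:R ^+ 3 / p%:R + M%:R `^ (3 - m%:R)).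
Proof.
move=> pp sf m0 k0 M1 C0 hJ.
have M0 : (0 : K) < M%:R by rewrite ltr0n ltnW.
have p0 : (0 : K) < p%:R by rewrite ltr0n prime_gt0.
have := mean_value_bound p m k M f s pp sf m0 k0 (ltnW M1).
rewrite -(ler_nat K) !(natrM, natrX, natrD) => h.
set X := (cnt _ _)%:R in h *.
have assoc (a b c d e g : K) : a * b * c * d * e * g = a * (b * (c * (d * (e * g)))).
  by rewrite !mulrA.
rewrite exprMn assoc ler_wpM2l ?exprn_ge0 // -(ler_pM2r p0).
apply: (le_trans h).
apply: (@le_trans _ _ ((2 * k%:R) ^+ m.+2 * (M%:R ^+ 'C(m, 2) * M%:R ^+ 3) *
    (M%:R ^+ m + p%:R) * (C * M%:R `^ ((2 * k)%:R - (m * m.+1)%:R / 2 + oM)))).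
  rewrite exprD ler_wpM2l // !mulr_ge0 ?exprn_ge0 ?addr_ge0 ?mulr_ge0 ?exprn_ge0 ?ltW //.
have MN : (M%:R == 0 :> K) = false by rewrite gt_eqF.
have -> : M%:R ^+ 'C(m, 2) * M%:R ^+ 3 = M%:R `^ (m%:R * (m%:R - 1) / 2 + 3) :> K.
  by rewrite -exprD -powR_mulrn ?ltW // natrD bin2_natr.
have clear_den (u v w z a b : K) :
    u * (v * (w * (z * (a / p%:R + b)))) * p%:R = u * v * w * z * (a + b * p%:R).
  by field; rewrite gt_eqF.
rewrite clear_den -natrM.
have -> : M%:R ^+ 3 + M%:R `^ (3 - m%:R) * p%:R =
   M%:R `^ (3 - m%:R) * (M%:R ^+ m + p%:R) :> K.
  rewrite mulrDr; congr (_ + _); rewrite -!powR_mulrn ?ltW //.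
  by rewrite -powRD ?MN ?implybT // subrK.
have -> : M%:R ^+ (2 * k) = M%:R `^ (2 * k)%:R :> K by rewrite powR_mulrn ?ltW.
have hexp : M%:R `^ (m%:R * (m%:R - 1) / 2 + 3) *
   M%:R `^ ((2 * k)%:R - (m * m.+1)%:R / 2 + oM) =
   M%:R `^ oM * M%:R `^ (2 * k)%:R * M%:R `^ (3 - m%:R) :> K.
  rewrite -!powRD ?MN ?implybT //; congr (_ `^ _).
  by rewrite !natrM -[m.+1%:R]natr1; field.
rewrite le_eqVlt; apply/orP; left; apply/eqP.
have regroup (u a q c b : K) : u * a * q * (c * b) = u * c * (a * b) * q by ring.
rewrite regroup hexp; ring.
Qed.

(** Take [Q] largest with [Q^E <= M]; the threshold [M1] ensures [Q >= 2^(2 k)]. With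
    [x = M^(1 / (4 E))], the bounds [x^2 < Q] and [Q >= 4] give [2 x <= Q], which absorbs the factor
    2. *)
Lemma sparse_curve_real (K : realType) m k : (3 < m)%N -> (0 < k)%N ->
  exists E M1 : nat, (0 < E)%N /\
  forall M p (f : {poly 'F_p}) (s : 'F_p), prime p -> size f = m.+1 ->
    (M1 <= M < p)%N -> (M ^ 3 <= 2 ^ (2 * k) * p)%N ->
    2 * (cnt M (on_curve p f s M))%:R <=
      M%:R * M%:R `^ (- (4 * E%:R)^-1) :> K.
Proof.
move=> m4 k0; have [E0 hE] := sparse_curve m m4.
exists E0.+1, ((2 ^ (2 * k)) ^ E0.+1)%N; split=> // M p f s pp sf /andP[M1 Mp] Mp3.
set E := E0.+1 in M1 *.
have B1 : (3 < 2 ^ (2 * k))%N.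
  by rewrite (@leq_trans (2 ^ 2)) // leq_exp2l // -[2%N]muln1 leq_pmul2l.
have [//||Q [BQ QE MQ]] := nat_root E _ M _ _ M1; first by lia.
have Q1 : (3 < Q)%N by exact: leq_trans BQ.
have M0 : (0 < M)%N by rewrite (leq_trans _ QE) // expn_gt0; lia.
have hs : (Q * cnt M (on_curve p f s M) < M)%N.
  apply: hE => //; first by lia.
    by rewrite Mp andbT (leq_trans _ QE) // leq_exp2l //; lia.
  by rewrite (leq_trans Mp3) // leq_mul2r BQ orbT.
have MK : (0 : K) < M%:R by rewrite ltr0n.
set x : K := M%:R `^ ((4 * E%:R)^-1).
have x0 : 0 < x by exact: powR_gt0.
have hx : (x ^+ 2) ^+ (2 * E) = M%:R.
  rewrite -exprM -powR_mulrn ?powR_ge0 // -powRrM (_ : _ * _ = 1) ?powRr1 ?ltW //.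
  rewrite !natrM; field; by rewrite pnatr_eq0.
have xQ : x ^+ 2 < Q%:R.
  have E20 : (0 < 2 * E)%N by rewrite muln_gt0.
  have hlt : (x ^+ 2) ^+ (2 * E) < Q%:R ^+ (2 * E) by rewrite hx -natrX ltr_nat.
  by move: hlt; rewrite ltr_pXn2r ?nnegrE ?exprn_ge0 ?(ltW x0).
have Q4 : (4 : K) <= Q%:R by rewrite ler_nat.
have x2Q : 2 * x <= Q%:R.
  rewrite -(@ler_pXn2r _ 2%N) ?nnegrE ?mulr_ge0 ?(ltW x0) //.
  have h4 : 4 * Q%:R <= Q%:R * Q%:R :> K by rewrite ler_wpM2r.
  by rewrite exprMn -[Q%:R ^+ 2]/(Q%:R * Q%:R); move: (x ^+ 2) xQ h4 => y; lra.
rewrite powRN ler_pdivlMr //.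
apply: (@le_trans _ _ (Q%:R * (cnt M (on_curve p f s M))%:R)).
  by rewrite mulrAC ler_wpM2r.
by rewrite -natrM ler_nat ltnW.
Qed.

Theorem theorem4 (K : realType) (m kappa : nat)
    (hm : (4 <= m)%N) (hkappa : is_kappa K m kappa) :
  exists theta1 theta2 : forall M p : nat, {poly 'F_p} -> int -> int -> K,
    uniform_o1 m theta1 /\ uniform_o1 m theta2 /\
    forall (M p : nat) (f : {poly 'F_p}) (R S : int),
      admissible m M f ->
      (curve_points f M R S)%:R <=
        M%:R * (M%:R ^+ 3 / p%:R)
                 `^ (1 / (2 * kappa%:R) + theta1 M p f R S)
        + M%:R `^ (1 - (m%:R - 3) / (2 * kappa%:R) + theta2 M p f R S).
Proof.
have [[k0 hJ] _] := hkappa; have [C [w [w0 [N _ hN]]]] := hJ _ (leqnn kappa).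
set k := kappa in k0 w0 hN *.
have [E [M1 [E0 hsparse]]] := sparse_curve_real K m k hm k0.
(* The factor 2 comes from [a + b <= 2 max(a, b)]; the summand 1 ensures [C' >= 1], hence a
   nonnegative slack. *)
pose C' : K := 2 * (2 ^+ (2 * k) * (2 * k)%:R ^+ m.+2 * `|C|) + 1.
have c0 : 0 <= 2 ^+ (2 * k) * (2 * k)%:R ^+ m.+2 * `|C| :> K.
  apply: mulr_ge0; [apply: mulr_ge0; apply: exprn_ge0 | exact: normr_ge0].
  by []. by rewrite ler0n.
have C'1 : 1 <= C' by rewrite /C' lerDr mulr_ge0.
pose om M := slack K C' w k M.
(* Chosen so that [M^(- eta)] to the power [1 / (2 k)] is the saving [M^(- 1 / (4 E))] of
   [sparse_curve_real]. *)
pose eta : K := k%:R / (2 * E%:R).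
have kK : 0 < k%:R :> K by rewrite ltr0n.
have EK : 0 < E%:R :> K by rewrite ltr0n.
have eta0 : 0 < eta by rewrite divr_gt0 // mulr_gt0.
pose M0 := maxn 2 (maxn N M1).
pose far (M p : nat) := (M%:R ^+ 3 / p%:R <= M%:R `^ (- eta) :> K).
(* In the far range this gives [a^theta1 = M^om] for [a = M^3 / p], and [ln a <= - eta ln M < 0]
   bounds it by [om / eta]. *)
pose theta1 (M p : nat) (_ : {poly 'F_p}) (_ _ : int) : K :=
  if (M0 <= M)%N && far M p then om M * ln M%:R / ln (M%:R ^+ 3 / p%:R) else 0.
(* Below [M0] the exponent of the second term becomes 2, and [M^2] bounds the count trivially. *)
pose theta2 (M p : nat) (_ : {poly 'F_p}) (_ _ : int) : K :=
  if (M0 <= M)%N then om M else (m%:R - 3) / (2 * k%:R) + 1.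
have om_ge0 M : (M0 <= M)%N -> 0 <= om M.
  by move=> hM; apply: slack_ge0 => //; apply: leq_trans hM; rewrite leq_maxl.
have far_ln M p : (M0 <= M)%N -> (0 < p)%N -> far M p ->
    ln (M%:R ^+ 3 / p%:R : K) <= - (eta * ln M%:R) /\ 0 < ln (M%:R : K).
  move=> hM p0 hfar; have M1' : (1 < M)%N by apply: leq_trans hM; rewrite leq_maxl.
  have MK : (0 : K) < M%:R by rewrite ltr0n ltnW.
  split; last by rewrite ln_gt0 // ltr1n.
  by rewrite -mulNr -ln_powR ler_ln ?posrE ?powR_gt0 ?divr_gt0 ?exprn_gt0 // ltr0n.
exists theta1, theta2; split; [|split].
- move=> eps eps0; have eta_eps : 0 < eps * eta by exact: mulr_gt0.
  have hom := slack_small K C' w k _ C'1 k0 w0 eta_eps.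
  near=> M => p f R S [pp _ /andP[Ml _]].
  rewrite /theta1; case: ifP => [/andP[hM hfar]|_]; last by rewrite normr0.
  have [hl l0] := far_ln _ _ hM (prime_gt0 pp) hfar.
  have lneg : ln (M%:R ^+ 3 / p%:R : K) < 0.
    by apply: le_lt_trans hl _; rewrite oppr_lt0 mulr_gt0.
  rewrite normrM normfV (ltr0_norm lneg) (ger0_norm (mulr_ge0 (om_ge0 _ hM) (ltW l0))).
  rewrite ltr_pdivrMr ?oppr_gt0 //.
  apply: (@lt_le_trans _ _ (eps * eta * ln M%:R)).
    by rewrite ltr_pM2r //; near: M.
  by rewrite -mulrA ler_pM2l // lerNr.
- move=> eps eps0; have hom := slack_small K C' w k _ C'1 k0 w0 eps0.
  near=> M => p f R S _.
  have hM : (M0 <= M)%N by near: M; exact: nbhs_infty_ge.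
  by rewrite /theta2 hM (ger0_norm (om_ge0 _ hM)); near: M.
move=> M p f R S [pp sf /andP[Ml Mp]].
set I := (curve_points f M R S)%:R : K.
have hI := curve_points_le p f M R S pp Mp.
set g := f \Po _ in hI; set s := (S + 1)%:~R in hI.
set X := cnt _ _ in hI.
have sg : size g = m.+1 by rewrite size_comp_XaddC.
have MK : (0 : K) < M%:R by rewrite ltr0n.
have pK : (0 : K) < p%:R by rewrite ltr0n prime_gt0.
have IX : I <= 2 * X%:R by rewrite -natrM ler_nat.
have IM : I <= 2 * M%:R.
  by rewrite (le_trans IX) // ler_pM2l // ler_nat cnt_leN.
have t1 e : 0 <= M%:R * (M%:R ^+ 3 / p%:R : K) `^ e by rewrite mulr_ge0 ?powR_ge0 ?ltW.
have t2 e : 0 <= (M%:R : K) `^ e by exact: powR_ge0.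
have [hM|hM] := leqP M0 M; last first.
  apply: ler_wpDl; first exact: t1.
  have -> : theta2 M p f R S = (m%:R - 3) / (2 * k%:R) + 1.
    by rewrite /theta2 leqNgt hM.
  have -> : 1 - (m%:R - 3) / (2 * k%:R) + ((m%:R - 3) / (2 * k%:R) + 1) = 2 :> K.
    by ring.
  rewrite (powR_mulrn 2 (ltW MK)) -natrX ler_nat.
  by rewrite (leq_trans (max_card _)) // card_prod !card_ord mulnn.
have M2 : (1 < M)%N by apply: leq_trans hM; rewrite leq_maxl.
have hNM : (N <= M)%N by apply: leq_trans hM; rewrite !leq_max leqnn orbT.
have hM1 : (M1 <= M)%N by apply: leq_trans hM; rewrite !leq_max leqnn !orbT.
rewrite /theta2 hM.
set a : K := M%:R ^+ 3 / p%:R; set b : K := M%:R `^ (3 - m%:R).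
have a0 : 0 < a by rewrite divr_gt0 ?exprn_gt0.
have b0 : 0 < b by exact: powR_gt0.
have k2 : 2 * k%:R != 0 :> K by rewrite gt_eqF // mulr_gt0.
have hmax : I <= M%:R * M%:R `^ om M * Num.max a b `^ ((2 * k)%:R^-1).
  have hmv := mean_value_real K m k p M g s `|C| (w M) pp sg (ltnW (ltnW (ltnW hm)))
    k0 M2 (normr_ge0 C) _.
  have {}hmv := hmv (le_trans (hN M hNM) (ler_wpM2r (powR_ge0 _ _) (ler_norm C))).
  have mx0 : 0 < Num.max a b by rewrite lt_max a0.
  have y0 : 0 < M%:R * M%:R `^ om M by rewrite mulr_gt0 ?powR_gt0.
  rewrite mulrC -ler_pdivrMr //; apply: le_powR_root.
  - by rewrite muln_gt0.
  - by rewrite divr_ge0 ?ler0n // ltW.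
  rewrite expr_div_n ler_pdivrMr ?exprn_gt0 // exprMn.
  have hI2 : I ^+ (2 * k) <= (2 * X%:R) ^+ (2 * k).
    by rewrite lerXn2r ?nnegrE ?mulr_ge0 ?ler0n.
  apply: (le_trans hI2); apply: (le_trans hmv).
  have hs := powR_slack K C' w k M C'1 M2 k0; rewrite -/(om M) in hs.
  have wM0 : 0 <= M%:R `^ w M :> K by exact: powR_ge0.
  have hab : a + b <= 2 * Num.max a b.
    by rewrite mulr_natl mulr2n lerD // le_max lexx ?orbT.
  set c := 2 ^+ (2 * k) * _ ^+ m.+2 * `|C| in c0 *.
  have M2k : 0 <= M%:R ^+ (2 * k) :> K by rewrite exprn_ge0 ?ler0n.
  apply: (@le_trans _ _ (c * M%:R `^ w M * M%:R ^+ (2 * k) * (2 * Num.max a b))).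
    by rewrite ler_wpM2l // mulr_ge0 // mulr_ge0.
  apply: (@le_trans _ _ (C' * M%:R `^ w M * (M%:R ^+ (2 * k) * Num.max a b))).
    rewrite (_ : c * _ * _ * _ = 2 * c * M%:R `^ w M * (M%:R ^+ (2 * k) * Num.max a b)); last by ring.
    rewrite ler_wpM2r ?mulr_ge0 // ?(ltW mx0) // ler_wpM2r // /C' -/c; lra.
  rewrite [leRHS](_ : _ = (M%:R `^ om M) ^+ (2 * k) * (M%:R ^+ (2 * k) * Num.max a b)); last by ring.
  by rewrite ler_wpM2r // mulr_ge0 // ltW.
(* In the far range the maximum is [b] or [a], and [M^om] enters the exponent of the second or first
   term accordingly. *)
have [hfar|hnear] := boolP (far M p).
  have -> : theta1 M p f R S = om M * ln M%:R / ln a by rewrite /theta1 hM hfar.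
  have [hln lnM] := far_ln M p hM (prime_gt0 pp) hfar.
  have a1 : a != 1.
    apply/eqP => e; move: hln; rewrite -/a e ln1 lerNr oppr0 leNgt.
    by rewrite mulr_gt0.
  move: hmax; rewrite maxEle; case: ifP => _ /le_trans; apply.
    apply: ler_wpDl; first exact: t1.
    rewrite le_eqVlt; apply/orP; left; apply/eqP.
    rewrite -[X in X * _ * _](powRr1 (ltW MK)) /b -powRrM.
    rewrite -!powRD ?(gt_eqF MK) ?implybT //; congr (_ `^ _).
    by rewrite natrM; field; rewrite gt_eqF.
  apply: ler_wpDr; first exact: t2.
  rewrite le_eqVlt; apply/orP; left; apply/eqP.
  rewrite powRD ?(gt_eqF a0) ?implybT // powR_shift // natrM div1r; ring.
(* In the near range the first term suffices: trivially if [a >= 2^(2 k)], otherwise by the power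
   saving, since [a > M^(- eta)]. *)
have hroot : I <= M%:R * a `^ (1 / (2 * k%:R)).
  have [ha|ha] := leP (2 ^+ (2 * k)) a.
    apply: (le_trans IM); rewrite mulrC ler_pM2l //.
    rewrite div1r -natrM; apply: le_powR_root => //; first by rewrite muln_gt0 k0.
  have hp : (M ^ 3 <= 2 ^ (2 * k) * p)%N.
    rewrite -(ler_nat K) natrX natrM natrX -ler_pdivrMr //; exact: ltW.
  apply: (le_trans IX); apply: (le_trans (hsparse M p g s pp sg _ hp)).
    by rewrite hM1 Mp.
  rewrite ler_pM2l //.
  have -> : - (4 * E%:R)^-1 = - eta * (1 / (2 * k%:R)) :> K.
    by rewrite /eta; field; rewrite !gt_eqF.
  rewrite powRrM; apply: ge0_ler_powR.
  - by rewrite divr_ge0 // mulr_ge0 // ltW.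
  - by rewrite nnegrE powR_ge0.
  - by rewrite nnegrE ltW.
  - by rewrite ltW // ltNge.
rewrite (le_trans hroot) //.
have -> : theta1 M p f R S = 0 by rewrite /theta1 (negPf hnear) andbF.
by rewrite addr0 lerDl.
Unshelve. all: by end_near. Qed.
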